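(* Let $(\mathcal{C},\otimes,1)$ be a monoidal category (not necessarily closed) such that $\otimes$ preserves colimits in both entries, let $(P,Q)$ be a pivotal pair in $\mathcal{C}$, and assume that suitable colimits exist so that the bimonad $T$ described in the context can be constructed. Then $T$ is a Hopf monad, i.e. its fusion operators $$H^l_{X,Y}=(\mathrm{id}_{T(X)}\otimes\mu_Y)T_2(X,T(Y)):T(X\otimes T(Y))\to T(X)\otimes T(Y),$$ $$H^r_{X,Y}=(\mu_X\otimes\mathrm{id}_{T(Y)})T_2(T(X),Y):T(T(X)\otimes Y)\to T(X)\otimes T(Y)$$ are invertible for all objects $X,Y$ of $\mathcal{C}$.
   Context: Monoidal categories are treated as strict, and an object's name also denotes its identity morphism. A pivotal pair $(P,Q)$ in $\mathcal{C}$ consists of objects $P,Q$ with chosen morphisms $\mathrm{coev}:1\to P\otimes Q$, $\mathrm{ev}:Q\otimes P\to 1$ making $Q$ a left dual of $P$, and $\underline{\mathrm{coev}}:1\to Q\otimes P$, $\underline{\mathrm{ev}}:P\otimes Q\to 1$ making $Q$ a right dual of $P$ (each pair satisfying the usual triangle identities). Construction of $T$. Put $F_+(X)=Q\otimes X\otimes P$ and $F_-(X)=P\otimes X\otimes Q$. For a finite word $i=(i_1,\dots,i_n)\in\{+,-\}^n$, $n\ge 0$, put $F_i=F_{i_1}F_{i_2}\cdots F_{i_n}$ (identity functor for the empty word). Let $F^\star=\coprod_i F_i$ be the coproduct over all finite words, with natural transformations $\iota_i:F_i\to F^\star$. For every word $i$ there are four parallel pairs into $F^\star$: (1) $\iota_{-,+,i}\,(P\otimes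 Q\otimes F_i\otimes\mathrm{coev})$ and $\iota_{i}\,(\underline{\mathrm{ev}}\otimes F_i)$ from $P\otimes Q\otimes F_i$; (2) $\iota_{+,-,i}\,(\underline{\mathrm{coev}}\otimes F_i\otimes Q\otimes P)$ and $\iota_{i}\,(F_i\otimes\mathrm{ev})$ from $F_i\otimes Q\otimes P$; (3) $\iota_{+,-,i}\,(Q\otimes P\otimes F_i\otimes\underline{\mathrm{coev}})$ and $\iota_{i}\,(\mathrm{ev}\otimes F_i)$ from $Q\otimes P\otimes F_i$; (4) $\iota_{-,+,i}\,(\mathrm{coev}\otimes F_i\otimes P\otimes Q)$ and $\iota_{i}\,(F_i\otimes\underline{\mathrm{ev}})$ from $F_i\otimes P\otimes Q$. $T$ is the colimit, in the category of endofunctors of $\mathcal{C}$, of the diagram formed by all these parallel pairs, with universal natural transformation $\psi:F^\star\to T$. Write $\psi_i=\psi\iota_i:F_i\to T$, and $\psi_0$ for the case of the empty word. Monad structure: the unit is $\eta=\psi_0:\mathrm{id}_{\mathcal{C}}\to T$; the multiplication $\mu:TT\to T$ is the unique natural transformation with $\mu_X(\psi_i)_{T(X)}F_i((\psi_j)_X)=(\psi_{i,j})_X$ for all words $i,j$ (where $i,j$ as an index denotes concatenation). Comonoidal structure: define $\mathrm{coev}_{i}:1\to F_{-i_n,\dots,-i_1}(1)$ for words $i=(i_1,\dots,i_n)$ recursively by $\mathrm{coev}_{+}=\mathrm{coev}$, $\mathrm{coev}_-=\underline{\mathrm{coev}}$, $\mathrm{coev}_{\pm,i_1,\dots,i_n}=F_{-i_n,\dots,-i_1}(\mathrm{coev}_\pm)\,\mathrm{coev}_{i_1,\dots,i_n}$,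 and $\mathrm{ev}_i:F_i(1)\to 1$ by $\mathrm{ev}_+=\mathrm{ev}$, $\mathrm{ev}_-=\underline{\mathrm{ev}}$, $\mathrm{ev}_{\pm,i}=\mathrm{ev}_\pm F_\pm(\mathrm{ev}_i)$ (identities for the empty word). Then $T_2(X,Y):T(X\otimes Y)\to T(X)\otimes T(Y)$ and $T_0:T(1)\to 1$ are the unique morphisms with $T_2(X,Y)(\psi_i)_{X\otimes Y}=((\psi_i)_X\otimes(\psi_i)_Y)\,F_i(X\otimes\mathrm{coev}_i\otimes Y)$ (using $F_i(X\otimes F_{-i_n,\dots,-i_1}(1)\otimes Y)=F_i(X)\otimes F_i(Y)$) and $T_0(\psi_i)_1=\mathrm{ev}_i$. With these structures $T$ is a bimonad (a monad whose functor is comonoidal and whose multiplication and unit are comonoidal natural transformations). *)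

(* Defs.v *)
From Stdlib Require Import List ProofIrrelevance FunctionalExtensionality.
Import ListNotations.

Set Implicit Arguments.
Unset Strict Implicit.
Unset Printing Implicit Defensive.
Set Primitive Projections.

Declare Scope cat_scope.
Delimit Scope cat_scope with cat.
Local Open Scope cat_scope.

Record category := Category {
  ob :> Type;
  hom : ob -> ob -> Type;
  idm : forall A, hom A A;
  comp : forall A B D, hom B D -> hom A B -> hom A D;
  comp1m : forall A B (f : hom A B), comp (idm B) f = f;
  compm1 : forall A B (f : hom A B), comp f (idm A) = f;
  compA : forall A B D E (h : hom D E) (g : hom B D) (f : hom A B),
    comp h (comp g f) = comp (comp h g) f }.

Arguments idm {c} A.
Arguments comp {c A B D} g f : rename.

Notation "A ~> B" := (hom A B) (at level 70, no associativity) : cat_scope.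
Notation "g ∘ f" := (comp g f) (at level 40, left associativity) : cat_scope.

Definition is_iso (C : category) (A B : C) (f : A ~> B) : Prop :=
  exists g : B ~> A, g ∘ f = idm A /\ f ∘ g = idm B.

(** The identity of [A] seen as a morphism [A ~> B] along [e : A = B]; by
    proof irrelevance it does not depend on [e]. *)
Definition eqm (C : category) (A B : C) (e : A = B) : A ~> B :=
  match e in _ = B return A ~> B with eq_refl => idm A end.

(** Equality of morphisms whose domains and codomains are not
    definitionally equal: [f ≈ g] includes equality of the (co)domains. *)
Inductive same (C : category) (A B : C) (f : A ~> B) :
    forall A' B' : C, A' ~> B' -> Prop :=
  same_refl : same f f.

Notation "f ≈ g" := (same f g) (at level 70, no associativity) : cat_scope.

Record functor (C D : category) := Functor {
  fob :> C -> D;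
  fmap : forall A B, A ~> B -> fob A ~> fob B;
  fmap1 : forall A, fmap (idm A) = idm (fob A);
  fmapM : forall A B E (g : B ~> E) (f : A ~> B),
    fmap (g ∘ f) = fmap g ∘ fmap f }.

Arguments fmap {C D} f [A B] _ : rename.

Definition idF (C : category) : functor C C :=
  {| fob := fun A => A; fmap := fun A B f => f;
     fmap1 := fun A => eq_refl; fmapM := fun A B E g f => eq_refl |}.

Lemma compF_id (C D E : category) (G : functor D E) (F : functor C D) (A : C) :
  fmap G (fmap F (idm A)) = idm (G (F A)).
Proof. now rewrite !fmap1. Qed.

Lemma compF_comp (C D E : category) (G : functor D E) (F : functor C D)
    (A B B' : C) (g : B ~> B') (f : A ~> B) :
  fmap G (fmap F (g ∘ f)) = fmap G (fmap F g) ∘ fmap G (fmap F f).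
Proof. now rewrite !fmapM. Qed.

Definition compF (C D E : category) (G : functor D E) (F : functor C D) :
    functor C E :=
  {| fob := fun A => G (F A); fmap := fun A B f => fmap G (fmap F f);
     fmap1 := compF_id G F; fmapM := compF_comp G F |}.

Record nattrans (C D : category) (F G : functor C D) := NatTrans {
  ncomp :> forall A, F A ~> G A;
  ncompE : forall A B (f : A ~> B), ncomp B ∘ fmap F f = fmap G f ∘ ncomp A }.

Lemma nattrans_ext (C D : category) (F G : functor C D) (s t : nattrans F G) :
  (forall A, s A = t A) -> s = t.
Proof.
destruct s as [s Hs], t as [t Ht]; simpl; intros H.
assert (E : s = t) by (apply functional_extensionality_dep; exact H).
subst t; f_equal; apply proof_irrelevance.
Qed.

Lemma ncomp_id_nat (C D : category) (F : functor C D) (A B : C) (f : A ~> B) :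
  idm (F B) ∘ fmap F f = fmap F f ∘ idm (F A).
Proof. now rewrite comp1m, compm1. Qed.

Definition idN (C D : category) (F : functor C D) : nattrans F F :=
  {| ncomp := fun A => idm (F A); ncompE := ncomp_id_nat F |}.

Lemma ncomp_comp_nat (C D : category) (F G H : functor C D)
    (t : nattrans G H) (s : nattrans F G) (A B : C) (f : A ~> B) :
  (t B ∘ s B) ∘ fmap F f = fmap H f ∘ (t A ∘ s A).
Proof. now rewrite <- compA, ncompE, compA, ncompE, compA. Qed.

Definition compN (C D : category) (F G H : functor C D)
    (t : nattrans G H) (s : nattrans F G) : nattrans F H :=
  {| ncomp := fun A => t A ∘ s A; ncompE := ncomp_comp_nat t s |}.

Definition fcat (C D : category) : category.
Proof.
refine {| ob := functor C D; hom := @nattrans C D; idm := @idN C D;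
          comp := @compN C D |}.
- intros F G s; apply nattrans_ext; intro A; apply comp1m.
- intros F G s; apply nattrans_ext; intro A; apply compm1.
- intros F G H K u t s; apply nattrans_ext; intro A; apply compA.
Defined.

Definition evalF (C D : category) (X : C) : functor (fcat C D) D.
Proof.
refine {| fob := fun F : fcat C D => (F : functor C D) X;
          fmap := fun (F G : fcat C D) (s : F ~> G) =>
                    (s : nattrans F G) X |}.
- intro F; reflexivity.
- intros F G H t s; reflexivity.
Defined.

(** Diagrams are indexed by directed graphs; a functor is a diagram on the
    underlying graph of its domain, with the same cocones. *)

Record graph := Graph { vert :> Type; edge : vert -> vert -> Type }.

Record diagram (J : graph) (C : category) := Diagram {
  dob :> J -> C;
  darr : forall u v : J, edge u v -> dob u ~> dob v }.

Arguments darr {J C} d [u v] _ : rename.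

Record cocone (J : graph) (C : category) (D : diagram J C) := Cocone {
  apex : C;
  leg : forall v : J, D v ~> apex;
  legE : forall (u v : J) (e : edge u v), leg v ∘ darr D e = leg u }.

Arguments leg {J C D} c v : rename.

Definition is_colimit (J : graph) (C : category) (D : diagram J C)
    (c : cocone D) : Prop :=
  forall c' : cocone D,
    exists! h : apex c ~> apex c', forall v, h ∘ leg c v = leg c' v.

Definition has_colimit (J : graph) (C : category) (D : diagram J C) : Prop :=
  exists c : cocone D, is_colimit c.

Definition map_diagram (J : graph) (C C' : category) (F : functor C C')
    (D : diagram J C) : diagram J C' :=
  {| dob := fun v => F (D v); darr := fun u v e => fmap F (darr D e) |}.

Lemma map_legE (J : graph) (C C' : category) (F : functor C C')
    (D : diagram J C) (c : cocone D) (u v : J) (e : edge u v) :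
  fmap F (leg c v) ∘ darr (map_diagram F D) e = fmap F (leg c u).
Proof. simpl; now rewrite <- fmapM, legE. Qed.

Definition map_cocone (J : graph) (C C' : category) (F : functor C C')
    (D : diagram J C) (c : cocone D) : cocone (map_diagram F D) :=
  {| apex := F (apex c); leg := fun v => fmap F (leg c v) : map_diagram F D v ~> _;
     legE := map_legE F c |}.

Definition preserves_colimits (C C' : category) (F : functor C C') : Prop :=
  forall (J : graph) (D : diagram J C) (c : cocone D),
    is_colimit c -> is_colimit (map_cocone F c).

Record smoncat := SMonCat {
  mcat :> category;
  tens : mcat -> mcat -> mcat;
  unito : mcat;
  tensm : forall A B A' B' : mcat,
    A ~> A' -> B ~> B' -> tens A B ~> tens A' B';
  tensm_id : forall A B : mcat, tensm (idm A) (idm B) = idm (tens A B);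
  tensm_comp : forall (A B A' B' A'' B'' : mcat) (f' : A' ~> A'') (f : A ~> A')
      (g' : B' ~> B'') (g : B ~> B'),
    tensm (f' ∘ f) (g' ∘ g) = tensm f' g' ∘ tensm f g;
  tensA : forall A B D : mcat, tens (tens A B) D = tens A (tens B D);
  tens1o : forall A : mcat, tens unito A = A;
  tenso1 : forall A : mcat, tens A unito = A;
  tensmA : forall (A B D A' B' D' : mcat) (f : A ~> A') (g : B ~> B') (h : D ~> D'),
    tensm (tensm f g) h ≈ tensm f (tensm g h);
  tens1m : forall (A A' : mcat) (f : A ~> A'), tensm (idm unito) f ≈ f;
  tensm1 : forall (A A' : mcat) (f : A ~> A'), tensm f (idm unito) ≈ f }.

Arguments tens {s} A B : rename.
Arguments unito {s}.
Arguments tensm {s A B A' B'} f g : rename.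

Notation "A ⊗ B" := (tens A B) (at level 39, left associativity) : cat_scope.
Notation "f ⊠ g" := (tensm f g) (at level 39, left associativity) : cat_scope.
Notation "𝟙" := unito : cat_scope.

Section Same.
Variable C : category.

Lemma eqm_id (A : C) (e : A = A) : eqm e = idm A.
Proof. now rewrite (proof_irrelevance _ e eq_refl). Qed.

Lemma sameP (A B A' B' : C) (f : A ~> B) (g : A' ~> B') :
  f ≈ g -> exists (eA : A' = A) (eB : B = B'), g = eqm eB ∘ f ∘ eqm eA.
Proof.
intros []; exists eq_refl, eq_refl; simpl; now rewrite comp1m, compm1.
Qed.

Lemma same_eq (A B : C) (f g : A ~> B) : f ≈ g -> f = g.
Proof.
intros H; destruct (sameP H) as [eA [eB ->]].
now rewrite !eqm_id, comp1m, compm1.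
Qed.

Lemma eq_same (A B : C) (f g : A ~> B) : f = g -> f ≈ g.
Proof. intros ->; constructor. Qed.

Lemma same_sym (A B A' B' : C) (f : A ~> B) (g : A' ~> B') : f ≈ g -> g ≈ f.
Proof. intros []; constructor. Qed.

Lemma same_trans (A B A' B' A'' B'' : C)
    (f : A ~> B) (g : A' ~> B') (h : A'' ~> B'') : f ≈ g -> g ≈ h -> f ≈ h.
Proof. now intros []. Qed.

Lemma same_comp (A B D A' B' D' : C)
    (f : A ~> B) (g : B ~> D) (f' : A' ~> B') (g' : B' ~> D') :
  f ≈ f' -> g ≈ g' -> g ∘ f ≈ g' ∘ f'.
Proof.
intros Hf Hg.
destruct (sameP Hf) as [eA [eB ->]], (sameP Hg) as [eB' [eD ->]].
subst A' B' D'; rewrite (eqm_id eB'); simpl.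
rewrite !comp1m, !compm1; constructor.
Qed.

Lemma eqm_compl (A B B' : C) (f : A ~> B) (e : B = B') : eqm e ∘ f ≈ f.
Proof. destruct e; simpl; rewrite comp1m; constructor. Qed.

Lemma eqm_compr (A A' B : C) (f : A ~> B) (e : A' = A) : f ∘ eqm e ≈ f.
Proof. destruct e; simpl; rewrite compm1; constructor. Qed.
End Same.

Lemma same_tens (C : smoncat) (A B A' B' D E D' E' : C)
    (f : A ~> B) (g : D ~> E) (f' : A' ~> B') (g' : D' ~> E') :
  f ≈ f' -> g ≈ g' -> f ⊠ g ≈ f' ⊠ g'.
Proof. intros [] []; constructor. Qed.

Definition eqN (C D : category) (F G : functor C D) (e : forall X, F X = G X)
    (em : forall (X Y : C) (f : X ~> Y), fmap F f ≈ fmap G f) : nattrans F G.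
Proof.
refine {| ncomp := fun X => eqm (e X) |}.
intros X Y f; apply same_eq.
eapply same_trans; [apply eqm_compl|].
eapply same_trans; [apply em|apply same_sym, eqm_compr].
Defined.

Section Tensor.
Variable C : smoncat.

Definition tensl (A : C) : functor C C.
Proof.
refine {| fob := fun X => A ⊗ X; fmap := fun X Y f => idm A ⊠ f |}.
- intro X; apply tensm_id.
- intros X Y Z g f; rewrite <- tensm_comp, comp1m; reflexivity.
Defined.

Definition tensr (A : C) : functor C C.
Proof.
refine {| fob := fun X => X ⊗ A; fmap := fun X Y f => f ⊠ idm A |}.
- intro X; apply tensm_id.
- intros X Y Z g f; rewrite <- tensm_comp, comp1m; reflexivity.
Defined.

Definition sandwich (A B : C) : functor C C := compF (tensr B) (tensl A).

(** [G ⊗ u], [u ⊗ G], [G ⊗ v], [v ⊗ G], up to the strict unit laws. *)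

Definition insr (G : functor C C) (Z : C) (u : 𝟙 ~> Z) :
    nattrans G (compF (tensr Z) G).
Proof.
refine {| ncomp := fun X => (idm (G X) ⊠ u) ∘ eqm (eq_sym (tenso1 (G X)))
                            : G X ~> compF (tensr Z) G X |}.
intros X Y f; simpl; apply same_eq.
eapply (@same_trans _ _ _ _ _ _ _ _ ((idm (G Y) ⊠ u) ∘ (fmap G f ⊠ idm 𝟙))).
- apply same_comp; [apply same_sym, tensm1|apply eqm_compr].
- rewrite compA, <- !tensm_comp, !comp1m, !compm1; apply same_sym, eqm_compr.
Defined.

Definition insl (G : functor C C) (Z : C) (u : 𝟙 ~> Z) :
    nattrans G (compF (tensl Z) G).
Proof.
refine {| ncomp := fun X => (u ⊠ idm (G X)) ∘ eqm (eq_sym (tens1o (G X)))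
                            : G X ~> compF (tensl Z) G X |}.
intros X Y f; simpl; apply same_eq.
eapply (@same_trans _ _ _ _ _ _ _ _ ((u ⊠ idm (G Y)) ∘ (idm 𝟙 ⊠ fmap G f))).
- apply same_comp; [apply same_sym, tens1m|apply eqm_compr].
- rewrite compA, <- !tensm_comp, !comp1m, !compm1; apply same_sym, eqm_compr.
Defined.

Definition delr (G : functor C C) (Z : C) (v : Z ~> 𝟙) :
    nattrans (compF (tensr Z) G) G.
Proof.
refine {| ncomp := fun X => eqm (tenso1 (G X)) ∘ (idm (G X) ⊠ v)
                            : compF (tensr Z) G X ~> G X |}.
intros X Y f; simpl; apply same_eq.
eapply (@same_trans _ _ _ _ _ _ _ _ ((fmap G f ⊠ idm 𝟙) ∘ (idm (G X) ⊠ v))).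
- rewrite <- compA, <- !tensm_comp, !comp1m, !compm1; apply eqm_compl.
- apply same_comp; [apply same_sym, eqm_compl|apply tensm1].
Defined.

Definition dell (G : functor C C) (Z : C) (v : Z ~> 𝟙) :
    nattrans (compF (tensl Z) G) G.
Proof.
refine {| ncomp := fun X => eqm (tens1o (G X)) ∘ (v ⊠ idm (G X))
                            : compF (tensl Z) G X ~> G X |}.
intros X Y f; simpl; apply same_eq.
eapply (@same_trans _ _ _ _ _ _ _ _ ((idm 𝟙 ⊠ fmap G f) ∘ (v ⊠ idm (G X)))).
- rewrite <- compA, <- !tensm_comp, !comp1m, !compm1; apply eqm_compl.
- apply same_comp; [apply same_sym, eqm_compl|apply tens1m].
Defined.

Lemma sandwich2_ob (A B Z : C) :
  A ⊗ B ⊗ Z ⊗ (A ⊗ B) = A ⊗ (B ⊗ Z ⊗ A) ⊗ B.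
Proof. now rewrite !tensA. Qed.

Lemma sandwich2_ob' (A B Z : C) :
  A ⊗ B ⊗ (Z ⊗ (A ⊗ B)) = A ⊗ (B ⊗ Z ⊗ A) ⊗ B.
Proof. now rewrite !tensA. Qed.

Lemma sandwich2_hom' (A B X Y : C) (f : X ~> Y) :
  idm (A ⊗ B) ⊠ (f ⊠ idm (A ⊗ B))
    ≈ idm A ⊠ (idm B ⊠ f ⊠ idm A) ⊠ idm B.
Proof.
rewrite <- tensm_id.
eapply same_trans; [apply tensmA|].
eapply same_trans; [|apply same_sym, tensmA].
apply same_tens; [constructor|].
eapply same_trans; [|apply same_sym, same_tens; [apply tensmA|constructor]].
eapply same_trans; [|apply same_sym, tensmA].
apply same_tens; [constructor|].
apply same_sym, tensmA.
Qed.

Lemma sandwich2_hom (A B X Y : C) (f : X ~> Y) :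
  idm (A ⊗ B) ⊠ f ⊠ idm (A ⊗ B)
    ≈ idm A ⊠ (idm B ⊠ f ⊠ idm A) ⊠ idm B.
Proof. eapply same_trans; [apply tensmA|apply sandwich2_hom']. Qed.

Definition sandwich2 (A B : C) (G : functor C C) :
    nattrans (compF (tensr (A ⊗ B)) (compF (tensl (A ⊗ B)) G))
             (compF (sandwich A B) (compF (sandwich B A) G)) :=
  @eqN C C (compF (tensr (A ⊗ B)) (compF (tensl (A ⊗ B)) G))
       (compF (sandwich A B) (compF (sandwich B A) G))
       (fun X => sandwich2_ob A B (G X))
       (fun X Y f => sandwich2_hom A B (fmap G f)).

Definition sandwich2' (A B : C) (G : functor C C) :
    nattrans (compF (tensl (A ⊗ B)) (compF (tensr (A ⊗ B)) G))
             (compF (sandwich A B) (compF (sandwich B A) G)) :=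
  @eqN C C (compF (tensl (A ⊗ B)) (compF (tensr (A ⊗ B)) G))
       (compF (sandwich A B) (compF (sandwich B A) G))
       (fun X => sandwich2_ob' A B (G X))
       (fun X Y f => sandwich2_hom' A B (fmap G f)).
End Tensor.

Record bimonad (C : smoncat) (T : functor C C) := Bimonad {
  mu : nattrans (compF T T) T;
  eta : nattrans (idF C) T;
  cop : forall X Y : C, T (X ⊗ Y) ~> T X ⊗ T Y;
  cou : T 𝟙 ~> 𝟙;
  mu_assoc : forall X, mu X ∘ fmap T (mu X) = mu X ∘ mu (T X);
  mu_eta : forall X, mu X ∘ eta (T X) = idm (T X);
  mu_Teta : forall X, mu X ∘ fmap T (eta X) = idm (T X);
  cop_nat : forall (X X' Y Y' : C) (f : X ~> X') (g : Y ~> Y'),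
    cop X' Y' ∘ fmap T (f ⊠ g) = (fmap T f ⊠ fmap T g) ∘ cop X Y;
  cop_assoc : forall X Y Z : C,
    (cop X Y ⊠ idm (T Z)) ∘ cop (X ⊗ Y) Z
      ≈ (idm (T X) ⊠ cop Y Z) ∘ cop X (Y ⊗ Z);
  cop_coul : forall X : C, (cou ⊠ idm (T X)) ∘ cop 𝟙 X ≈ idm (T X);
  cop_cour : forall X : C, (idm (T X) ⊠ cou) ∘ cop X 𝟙 ≈ idm (T X);
  mu_cop : forall X Y : C,
    cop X Y ∘ mu (X ⊗ Y)
      = (mu X ⊠ mu Y) ∘ (cop (T X) (T Y) ∘ fmap T (cop X Y));
  mu_cou : cou ∘ mu 𝟙 = cou ∘ fmap T cou;
  eta_cop : forall X Y : C, cop X Y ∘ eta (X ⊗ Y) = eta X ⊠ eta Y;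
  eta_cou : cou ∘ eta 𝟙 = idm 𝟙 }.

Definition fusion_l (C : smoncat) (T : functor C C) (B : bimonad T) (X Y : C) :
    T (X ⊗ T Y) ~> T X ⊗ T Y :=
  (idm (T X) ⊠ mu B Y) ∘ cop B X (T Y).

Definition fusion_r (C : smoncat) (T : functor C C) (B : bimonad T) (X Y : C) :
    T (T X ⊗ Y) ~> T X ⊗ T Y :=
  (mu B X ⊠ idm (T Y)) ∘ cop B (T X) Y.

Definition is_hopf_monad (C : smoncat) (T : functor C C) (B : bimonad T) : Prop :=
  forall X Y : C, is_iso (fusion_l B X Y) /\ is_iso (fusion_r B X Y).

(** [coev], [ev] make [Q] a left dual of [P]; [coev'], [ev'] make it a right
    dual. *)
Record pivotal_pair (C : smoncat) (P Q : C) := PivotalPair {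
  coev : 𝟙 ~> P ⊗ Q;
  ev : Q ⊗ P ~> 𝟙;
  coev' : 𝟙 ~> Q ⊗ P;
  ev' : P ⊗ Q ~> 𝟙;
  triangle1 : (idm P ⊠ ev) ∘ eqm (tensA P Q P) ∘ (coev ⊠ idm P) ≈ idm P;
  triangle2 :
    (ev ⊠ idm Q) ∘ eqm (eq_sym (tensA Q P Q)) ∘ (idm Q ⊠ coev) ≈ idm Q;
  triangle1' : (idm Q ⊠ ev') ∘ eqm (tensA Q P Q) ∘ (coev' ⊠ idm Q) ≈ idm Q;
  triangle2' :
    (ev' ⊠ idm P) ∘ eqm (eq_sym (tensA P Q P)) ∘ (idm P ⊠ coev') ≈ idm P }.

Inductive sign := plus | minus.

Definition opp (s : sign) : sign :=
  match s with plus => minus | minus => plus end.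

Definition word := list sign.

Definition dualw (i : word) : word := rev (map opp i).

Section Construction.
Variables (C : smoncat) (P Q : C) (d : pivotal_pair P Q).

Definition Fsign (s : sign) : functor C C :=
  match s with plus => sandwich Q P | minus => sandwich P Q end.

Fixpoint Fword (i : word) : functor C C :=
  match i with
  | [] => idF C
  | s :: i => compF (Fsign s) (Fword i)
  end.

Lemma Fword_app (i j : word) (X : C) :
  Fword (i ++ j) X = Fword i (Fword j X).
Proof. induction i as [|s i IH]; simpl; [reflexivity|now rewrite IH]. Qed.

Lemma Fword_dual (i : word) (X Z Y : C) :
  Fword i (X ⊗ Fword (dualw i) Z ⊗ Y) = Fword i X ⊗ Z ⊗ Fword i Y.
Proof.
revert Z; induction i as [|s i IH]; intro Z; [reflexivity|].
unfold dualw in *; simpl; rewrite Fword_app; simpl; rewrite IH.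
destruct s; simpl; now rewrite !tensA.
Qed.

Lemma Fword_tens (i : word) (X Y : C) :
  Fword i (X ⊗ Fword (dualw i) 𝟙 ⊗ Y) = Fword i X ⊗ Fword i Y.
Proof. now rewrite Fword_dual, tenso1. Qed.

Definition words_graph : graph :=
  {| vert := word; edge := fun _ _ => Empty_set |}.

Definition words_diagram : diagram words_graph (fcat C C) :=
  {| dob := Fword : words_graph -> fcat C C;
     darr := fun u v (e : edge u v) => match e with end |}.

Inductive rel := rel1 | rel2 | rel3 | rel4.

Definition rel_src (k : rel) (i : word) : functor C C :=
  match k with
  | rel1 => compF (tensl (P ⊗ Q)) (Fword i)
  | rel2 => compF (tensr (Q ⊗ P)) (Fword i)
  | rel3 => compF (tensl (Q ⊗ P)) (Fword i)
  | rel4 => compF (tensr (P ⊗ Q)) (Fword i)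
  end.

Definition rel_word (k : rel) (i : word) : word :=
  match k with
  | rel1 | rel4 => minus :: plus :: i
  | rel2 | rel3 => plus :: minus :: i
  end.

Definition rel_fst (k : rel) (i : word) :
    nattrans (rel_src k i) (Fword (rel_word k i)) :=
  match k return nattrans (rel_src k i) (Fword (rel_word k i)) with
  | rel1 => compN (sandwich2 P Q (Fword i))
                  (insr (compF (tensl (P ⊗ Q)) (Fword i)) (coev d))
  | rel2 => compN (sandwich2' Q P (Fword i))
                  (insl (compF (tensr (Q ⊗ P)) (Fword i)) (coev' d))
  | rel3 => compN (sandwich2 Q P (Fword i))
                  (insr (compF (tensl (Q ⊗ P)) (Fword i)) (coev' d))
  | rel4 => compN (sandwich2' P Q (Fword i))
                  (insl (compF (tensr (P ⊗ Q)) (Fword i)) (coev d))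
  end.

Definition rel_snd (k : rel) (i : word) : nattrans (rel_src k i) (Fword i) :=
  match k return nattrans (rel_src k i) (Fword i) with
  | rel1 => dell (Fword i) (ev' d)
  | rel2 => delr (Fword i) (ev d)
  | rel3 => dell (Fword i) (ev d)
  | rel4 => delr (Fword i) (ev' d)
  end.

Inductive pairs_vert := source (k : rel) (i : word) | target.

Inductive pairs_edge : pairs_vert -> pairs_vert -> Type :=
| fst_edge (k : rel) (i : word) : pairs_edge (source k i) target
| snd_edge (k : rel) (i : word) : pairs_edge (source k i) target.

Definition pairs_graph : graph := {| vert := pairs_vert; edge := pairs_edge |}.

Section Pairs.
Variable coF : cocone words_diagram.

Definition iota (i : word) : nattrans (Fword i) (apex coF) := leg coF i.

Definition pairs_ob (v : pairs_graph) : fcat C C :=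
  match v with source k i => rel_src k i | target => apex coF end.

Definition pairs_arr (u v : pairs_graph) (e : edge u v) :
    pairs_ob u ~> pairs_ob v :=
  match e in pairs_edge u v return pairs_ob u ~> pairs_ob v with
  | fst_edge k i => compN (iota (rel_word k i)) (rel_fst k i)
  | snd_edge k i => compN (iota i) (rel_snd k i)
  end.

Definition pairs_diagram : diagram pairs_graph (fcat C C) :=
  {| dob := pairs_ob; darr := pairs_arr |}.

Definition psi (coT : cocone pairs_diagram) (i : word) :
    nattrans (Fword i) (apex coT) :=
  compN (leg coT (target : pairs_graph)) (iota i).
End Pairs.

Definition coev_sign (s : sign) : 𝟙 ~> Fsign (opp s) 𝟙 :=
  match s return 𝟙 ~> Fsign (opp s) 𝟙 with
  | plus => eqm (f_equal (fun A => A ⊗ Q) (eq_sym (tenso1 P))) ∘ coev d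
  | minus => eqm (f_equal (fun A => A ⊗ P) (eq_sym (tenso1 Q))) ∘ coev' d
  end.

Definition ev_sign (s : sign) : Fsign s 𝟙 ~> 𝟙 :=
  match s return Fsign s 𝟙 ~> 𝟙 with
  | plus => ev d ∘ eqm (f_equal (fun A => A ⊗ P) (tenso1 Q))
  | minus => ev' d ∘ eqm (f_equal (fun A => A ⊗ Q) (tenso1 P))
  end.

Fixpoint coev_word (i : word) : 𝟙 ~> Fword (dualw i) 𝟙 :=
  match i return 𝟙 ~> Fword (dualw i) 𝟙 with
  | [] => idm 𝟙
  | s :: i =>
      eqm (eq_sym (Fword_app (dualw i) [opp s] 𝟙))
        ∘ fmap (Fword (dualw i)) (coev_sign s) ∘ coev_word i
  end.

Fixpoint ev_word (i : word) : Fword i 𝟙 ~> 𝟙 :=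
  match i return Fword i 𝟙 ~> 𝟙 with
  | [] => idm 𝟙
  | s :: i => ev_sign s ∘ fmap (Fsign s) (ev_word i)
  end.

Record is_T_structure (coF : cocone words_diagram)
    (coT : cocone (pairs_diagram coF))
    (B : bimonad (apex coT : functor C C)) : Prop := IsTStructure {
  eta_psi : eta B = psi coT [];
  mu_psi : forall (i j : word) (X : C),
    mu B X ∘ psi coT i ((apex coT : functor C C) X) ∘ fmap (Fword i) (psi coT j X)
      = psi coT (i ++ j) X ∘ eqm (eq_sym (Fword_app i j X));
  cop_psi : forall (i : word) (X Y : C),
    cop B X Y ∘ psi coT i (X ⊗ Y)
      = (psi coT i X ⊠ psi coT i Y) ∘ eqm (Fword_tens i X Y)
          ∘ fmap (Fword i) ((idm X ⊠ coev_word i ⊠ idm Y)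
                              ∘ eqm (f_equal (fun A => A ⊗ Y) (eq_sym (tenso1 X))));
  cou_psi : forall i : word, cou B ∘ psi coT i 𝟙 = ev_word i }.
End Construction.

(* Main.v *)
Require Import Defs.
From Stdlib Require Import List FunctionalExtensionality ClassicalEpsilon.
Import ListNotations.

Set Implicit Arguments.
Unset Strict Implicit.
Unset Printing Implicit Defensive.
Local Open Scope cat_scope.

(** Let [A_i] and [B_i] be the tensor products of the letters of a word [i] for
    which [F_i X = A_i ⊗ X ⊗ B_i].  A pivotal pair makes the [A_i], [B_i] two-sided
    duals of each other, and the relations defining [T] say that [T X] is the
    universal receptacle of the [F_i X] in which a cup inserted on one side of
    [F_i X] is exchanged for a cap on the other side.

    The reason why [T] is Hopf is that every free algebra [M = T Y] is centralised
    by [P] and [Q].  Write [a_s : A_s ⊗ M ⊗ B_s -> M] for the action of a letter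
    and [-s] for the opposite letter.  Bending the leg [B_s] round with a cup
    turns [a_{-s}] into [r_s : B_s ⊗ M -> M ⊗ B_s] and [a_s] into a map
    [M ⊗ B_s -> B_s ⊗ M]; the relations of [T] and the triangle identities make
    them mutually inverse ([half_braidingK], [half_braiding_invK]), and make [r]
    natural with respect to cups and caps ([half_braiding_coev],
    [half_braiding_ev]).  Composing letter by letter gives an isomorphism
    [r_i : B_i ⊗ M -> M ⊗ B_i] for every word.

    By the formula defining [T_2], the left fusion operator composed with [psi_i]
    is [psi_i ⊗ M] after [A_i ⊗ X ⊗ r_i^-1 : F_i(X ⊗ M) -> F_i X ⊗ M].  So the
    inverse has to be [psi_i] after [A_i ⊗ X ⊗ r_i] on [F_i X ⊗ M].  As the tensor
    product preserves colimits, [T X ⊗ M] is universal for the families on the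
    [F_i X ⊗ M] compatible with the relations, and the naturality of [r] for cups
    and caps is exactly that compatibility ([inverse_balanced]).  Both composites
    are identities because [r_i^-1] is inverse to [r_i] ([fusion_iso]).

    The right fusion operator is the left one of the category with the reversed
    tensor product, in which [P] and [Q] exchange their roles.

    The universal property of [T X] in [C], as opposed to that of [T] among
    endofunctors, comes from the existence of the pointwise colimits
    ([eval_colimit]). *)

(** * Morphisms with strict tensor laws *)

(** The associativity and unit laws of a strict monoidal category hold only along
    equations between objects.  A morphism bundled with its ends makes them
    Leibniz equations, so that diagrams can be rewritten without transports.
    [None] is the composite of morphisms that do not fit: composition is then
    total and unconditionally associative, and the ends of an expression are
    known without any hypothesis. *)
Record mor (C : category) := Mor {
  src : C;
  tgt : C;
  arr : option (src ~> tgt) }.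

Definition hom_mor (C : category) (A B : C) (f : A ~> B) : mor C := Mor (Some f).
Coercion hom_mor : hom >-> mor.
Definition id_mor (C : category) (A : C) : mor C := idm A.
Coercion id_mor : ob >-> mor.

Definition mcomp (C : category) (g f : mor C) : mor C :=
  {| src := src f; tgt := tgt g;
     arr := match excluded_middle_informative (tgt f = src g), arr f, arr g with
            | left e, Some f0, Some g0 => Some (g0 ∘ eqm e ∘ f0)
            | _, _, _ => None
            end |}.

Definition mtens (C : smoncat) (f g : mor C) : mor C :=
  {| src := src f ⊗ src g; tgt := tgt f ⊗ tgt g;
     arr := match arr f, arr g with
            | Some f0, Some g0 => Some (f0 ⊠ g0)
            | _, _ => None
            end |}.

Notation "g ∙ f" := (mcomp g f) (at level 41, right associativity) : cat_scope.
Notation "f ⋆ g" := (mtens f g) (at level 38, right associativity) : cat_scope.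

Section Arrows.
Variable C : category.

Lemma same_mor (A B A' B' : C) (f : A ~> B) (g : A' ~> B') : f ≈ g -> f = g :> mor C.
Proof. now intros []. Qed.

Lemma mor_same (A B A' B' : C) (f : A ~> B) (g : A' ~> B') : f = g :> mor C -> f ≈ g.
Proof.
intros H.
assert (K : forall m m' : mor C, m = m' ->
    match arr m, arr m' with Some f, Some g => f ≈ g | _, _ => True end).
{ intros m _ <-; destruct (arr m); constructor. }
exact (K _ _ H).
Qed.

Lemma mor_inj (A B : C) (f g : A ~> B) : f = g :> mor C -> f = g.
Proof. intros H; apply same_eq, mor_same, H. Qed.

Lemma mor_none (A B A' B' : C) :
  A = A' -> B = B' -> @Mor C A B None = @Mor C A' B' None.
Proof. now intros -> ->. Qed.

Lemma mor_comp (A B D : C) (g : B ~> D) (f : A ~> B) : g ∘ f = g ∙ f :> mor C.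
Proof.
unfold mcomp; simpl; destruct excluded_middle_informative as [e|n]; [|now destruct n].
now rewrite eqm_id, compm1.
Qed.

Lemma mor_eqml (A B B' : C) (e : B = B') (f : A ~> B) : eqm e ∘ f = f :> mor C.
Proof. apply same_mor, eqm_compl. Qed.

Lemma mor_eqmr (A A' B : C) (e : A' = A) (f : A ~> B) : f ∘ eqm e = f :> mor C.
Proof. apply same_mor, eqm_compr. Qed.

Lemma mor_eqm (A B : C) (e : A = B) : eqm e = A :> mor C.
Proof. now destruct e. Qed.

Lemma mor_id (A : C) : idm A = A :> mor C.
Proof. reflexivity. Qed.

Lemma mcompA (h g f : mor C) : (h ∙ g) ∙ f = h ∙ g ∙ f.
Proof.
destruct f as [A B f], g as [B' D g], h as [D' E h]; unfold mcomp; simpl.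
f_equal.
destruct f, (excluded_middle_informative (B = B')) as [->|n],
  (excluded_middle_informative (D = D')) as [->|n'], g, h; try reflexivity.
- simpl; now rewrite !compA.
Qed.

Lemma mcomp1m (A : C) (f : mor C) : tgt f = A -> A ∙ f = f.
Proof.
intros <-; destruct f as [A B f]; unfold mcomp; simpl; f_equal.
destruct excluded_middle_informative as [e|n]; [|now destruct n].
destruct f; [now rewrite eqm_id, !comp1m|reflexivity].
Qed.

Lemma mcompm1 (A : C) (f : mor C) : src f = A -> f ∙ A = f.
Proof.
intros <-; destruct f as [A B f]; unfold mcomp; simpl; f_equal.
destruct excluded_middle_informative as [e|n]; [|now destruct n].
destruct f; [now rewrite eqm_id, !compm1|reflexivity].
Qed.
End Arrows.

Section TensorArrows.
Variable C : smoncat.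
Implicit Types f g h : mor C.

Lemma mtensA f g h : (f ⋆ g) ⋆ h = f ⋆ g ⋆ h.
Proof.
destruct f as [A A' [f|]], g as [B B' [g|]], h as [D D' [h|]]; unfold mtens; simpl;
  try (apply mor_none; apply tensA).
apply (same_mor (tensmA f g h)).
Qed.

Lemma mtens1m f : (𝟙 : C) ⋆ f = f.
Proof.
destruct f as [A A' [f|]]; unfold mtens; simpl.
- apply (same_mor (tens1m f)).
- apply mor_none; apply tens1o.
Qed.

Lemma mtensm1 f : f ⋆ (𝟙 : C) = f.
Proof.
destruct f as [A A' [f|]]; unfold mtens; simpl.
- apply (same_mor (tensm1 f)).
- apply mor_none; apply tenso1.
Qed.

Lemma mor_tensm (A B A' B' : C) (f : A ~> A') (g : B ~> B') : f ⊠ g = f ⋆ g :> mor C.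
Proof. reflexivity. Qed.

Lemma mor_tens (A B : C) : A ⊗ B = A ⋆ B :> mor C.
Proof. unfold id_mor; now rewrite <- tensm_id. Qed.

Lemma mtens_comp f' f g' g : tgt f = src f' -> tgt g = src g' ->
  (f' ∙ f) ⋆ (g' ∙ g) = (f' ⋆ g') ∙ (f ⋆ g).
Proof.
destruct f as [A A' f], f' as [A1 A'' f'], g as [B B' g], g' as [B1 B'' g'].
simpl; intros <- <-; unfold mcomp, mtens; simpl; f_equal.
repeat (destruct excluded_middle_informative as [?|n]; [|now destruct n]).
destruct f, f', g, g'; try reflexivity.
now rewrite !eqm_id, !compm1, tensm_comp.
Qed.

Lemma whiskl (U : C) g f : tgt f = src g -> U ⋆ (g ∙ f) = (U ⋆ g) ∙ (U ⋆ f).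
Proof. intros H; rewrite <- mtens_comp by easy. now rewrite mcomp1m. Qed.

Lemma whiskr (U : C) g f : tgt f = src g -> (g ∙ f) ⋆ U = (g ⋆ U) ∙ (f ⋆ U).
Proof. intros H; rewrite <- mtens_comp by easy. now rewrite mcomp1m. Qed.

(** Two boxes on disjoint strands may be applied in either order. *)
Lemma slide f g : (tgt f ⋆ g) ∙ (f ⋆ src g) = (f ⋆ tgt g) ∙ (src f ⋆ g).
Proof.
rewrite <- !mtens_comp by easy.
now rewrite !mcomp1m, !mcompm1.
Qed.
End TensorArrows.

Section Defined.
Variable C : smoncat.
Implicit Types f g : mor C.

Definition defined f := arr f <> None.

Lemma hom_defined (A B : C) (f : A ~> B) : defined f.
Proof. discriminate. Qed.

Lemma comp_defined g f : defined g -> defined f -> tgt f = src g -> defined (g ∙ f).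
Proof.
unfold defined; destruct f as [A B [f|]], g as [B' D [g|]]; simpl; try easy.
intros _ _ e; destruct excluded_middle_informative as [?|n]; easy.
Qed.

Lemma tens_defined g f : defined g -> defined f -> defined (g ⋆ f).
Proof. now unfold defined; destruct f as [A B [f|]], g as [B' D [g|]]. Qed.

Definition is_hom f (A B : C) := exists f0 : A ~> B, f = f0.

Lemma defined_hom f (A B : C) : defined f -> src f = A -> tgt f = B -> is_hom f A B.
Proof. destruct f as [A' B' [f|]]; intros D <- <-; [now exists f|easy]. Qed.
End Defined.

(** Composites are kept right nested, so an equation between composites is used in
    the form extended by an arbitrary tail. *)
Section Chains.
Variable C : category.
Implicit Types f g h k : mor C.

Lemma chain1 f h : f = h -> forall k, f ∙ k = h ∙ k.
Proof. now intros ->. Qed.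

Lemma chain2 f g h : g ∙ f = h -> forall k, g ∙ f ∙ k = h ∙ k.
Proof. intros <- k; now rewrite !mcompA. Qed.

Lemma chain3 f1 f2 f3 h : f3 ∙ f2 ∙ f1 = h -> forall k, f3 ∙ f2 ∙ f1 ∙ k = h ∙ k.
Proof. intros <- k; now rewrite !mcompA. Qed.
End Chains.

Section Ends.
Variable C : smoncat.
Lemma src_hom (A B : C) (f : A ~> B) : src (f : mor C) = A. Proof. reflexivity. Qed.
Lemma tgt_hom (A B : C) (f : A ~> B) : tgt (f : mor C) = B. Proof. reflexivity. Qed.
Lemma src_id (A : C) : src (A : mor C) = A. Proof. reflexivity. Qed.
Lemma tgt_id (A : C) : tgt (A : mor C) = A. Proof. reflexivity. Qed.
Lemma src_comp (g f : mor C) : src (g ∙ f) = src f. Proof. reflexivity. Qed.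
Lemma tgt_comp (g f : mor C) : tgt (g ∙ f) = tgt g. Proof. reflexivity. Qed.
Lemma src_tens (f g : mor C) : src (f ⋆ g) = src f ⊗ src g. Proof. reflexivity. Qed.
Lemma tgt_tens (f g : mor C) : tgt (f ⋆ g) = tgt f ⊗ tgt g. Proof. reflexivity. Qed.
End Ends.
Global Hint Rewrite src_hom tgt_hom src_id tgt_id src_comp tgt_comp src_tens tgt_tens
  tensA tens1o tenso1 : ends.
Global Hint Rewrite mor_tens mtensA mtens1m mtensm1 mcompA : strict.

(** Proves that two expressions have the same source or target, up to the strict
    laws. *)
Ltac ends := autorewrite with ends; reflexivity.

(** [slide f g as H] records the exchange of [f] on the left with [g] on the right,
    [whisker L E R as H] the equation [E] with strands [L] and [R] added on either
    side, and [chain E] rewrites with [E] inside a composite. *)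
Tactic Notation "slide" constr(f) constr(g) "as" ident(H) :=
  pose proof (@slide _ f g) as H; autorewrite with ends in H; autorewrite with strict in H.
Tactic Notation "whisker" constr(L) constr(E) constr(R) "as" ident(H) :=
  pose proof (f_equal (fun f => (L : mor _) ⋆ f ⋆ (R : mor _)) E) as H; cbn beta in H;
  repeat (rewrite whiskr in H by ends); repeat (rewrite whiskl in H by ends);
  autorewrite with strict in H.
Tactic Notation "chain" constr(E) :=
  let E' := lazymatch type of E with
            | _ ∙ _ ∙ _ = _ => constr:(chain3 E)
            | _ ∙ _ = _ => constr:(chain2 E)
            | _ => constr:(chain1 E)
            end in
  first [ rewrite E' | rewrite E ]; rewrite ?mcompA.
Tactic Notation "chain" "<-" constr(E) := chain (eq_sym E).
Ltac drop_id :=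
  rewrite <- ?mor_tens; rewrite ?mcomp1m, ?mcompm1 by ends; autorewrite with strict.

(** * Half-braidings from an action *)

(** [U] and [V] stand for the two legs [A_s], [B_s] of a letter, [a] and [a'] for the
    actions of that letter and of its opposite.  The three relations are those of
    [T] at the empty word. *)
Section HalfBraiding.
Variables (C : smoncat) (U V M : C).
Variables (c : 𝟙 ~> U ⊗ V) (e : U ⊗ V ~> 𝟙) (c' : 𝟙 ~> V ⊗ U) (e' : V ⊗ U ~> 𝟙).
Hypotheses (zigV : (V ⋆ e) ∙ (c' ⋆ V) = V) (zigU : (e ⋆ U) ∙ (U ⋆ c') = U).
Hypotheses (zigV' : (e' ⋆ V) ∙ (V ⋆ c) = V).
Variables (a : U ⊗ M ⊗ V ~> M) (a' : V ⊗ M ⊗ U ~> M).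
Hypotheses (rel_r : a ∙ (U ⋆ a' ⋆ V) ∙ (U ⋆ V ⋆ M ⋆ c) = e ⋆ M).
Hypotheses (rel_l : a ∙ (U ⋆ a' ⋆ V) ∙ (c ⋆ M ⋆ U ⋆ V) = M ⋆ e).
Hypotheses (rel_l' : a' ∙ (V ⋆ a ⋆ U) ∙ (c' ⋆ M ⋆ V ⋆ U) = M ⋆ e').

Let r := (a' ⋆ V) ∙ (V ⋆ M ⋆ c).
Let r' := (a ⋆ U) ∙ (U ⋆ M ⋆ c').
Let h := (V ⋆ a) ∙ (c' ⋆ M ⋆ V).

(** The cup [c'] of [r'] is moved below [a'], which leaves [a] and [a'] applied next
    to the given cup [c]: the left relation turns them into a cap, and this cap
    straightens against [c']. *)
Lemma half_braiding_coev : (r' ⋆ V) ∙ (U ⋆ r) ∙ (c ⋆ M) = M ⋆ c.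
Proof.
unfold r, r'; rewrite whiskl, whiskr by ends; autorewrite with strict.
slide (U ⋆ a') (c' ⋆ V) as S1. chain S1.
slide c (M ⋆ c) as S2. chain S2.
slide c (M ⋆ U ⋆ c' ⋆ V) as S3. chain S3.
whisker (𝟙 : C) rel_l (U ⊗ V) as R. chain R.
whisker M zigU V as Z. chain Z. drop_id. reflexivity.
Qed.

(** The cap is applied before [a] and straightens against the cup [c'], leaving the right
    relation. *)
Lemma half_braiding_ev : (M ⋆ e) ∙ (r' ⋆ V) ∙ (U ⋆ r) = e ⋆ M.
Proof.
unfold r, r'; rewrite whiskl, whiskr by ends; autorewrite with strict.
slide a e as S1. chain S1.
whisker (U ⊗ M) zigV (𝟙 : C) as Z. chain Z. drop_id. exact rel_r.
Qed.

(** The cup [c] is moved to the bottom; the left relation for the opposite letter then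
    leaves a zigzag. *)
Lemma half_braidingK : r ∙ h = M ⋆ V.
Proof.
unfold r, h; autorewrite with strict.
slide (V ⋆ a) c as S1. chain S1.
slide (c' ⋆ M ⋆ V) c as S2. chain S2.
whisker (𝟙 : C) rel_l' V as R. chain R.
whisker M zigV' (𝟙 : C) as Z. exact Z.
Qed.

(** Now the cup [c'] is moved to the bottom, and the right relation leaves a zigzag. *)
Lemma half_braiding_invK : h ∙ r = V ⋆ M.
Proof.
unfold r, h; autorewrite with strict.
slide c' (a' ⋆ V) as S1. chain <- S1.
slide c' (V ⋆ M ⋆ c) as S2. chain <- S2.
whisker V rel_r (𝟙 : C) as R. chain R.
whisker (𝟙 : C) zigV M as Z. exact Z.
Qed.
End HalfBraiding.

(** * Words and families compatible with the relations *)
Section Words.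
Variables (C : smoncat) (P Q : C).

Definition lsign (s : sign) : C := match s with plus => Q | minus => P end.
Definition rsign (s : sign) : C := match s with plus => P | minus => Q end.

Fixpoint lword (i : word) : C := match i with [] => 𝟙 | s :: i => lsign s ⊗ lword i end.
Fixpoint rword (i : word) : C := match i with [] => 𝟙 | s :: i => rword i ⊗ rsign s end.

(** The letter [s] carries a cup and a cap on [A_s ⊗ B_s].  Since [A_s = B_(opp s)],
    the cup of the opposite letter lives on [B_s ⊗ A_s], so that [zigl] and [zigr]
    for both letters are the four triangle identities of a pivotal pair. *)
Record duality := Duality {
  dcoev : forall s, 𝟙 ~> lsign s ⊗ rsign s;
  dev : forall s, lsign s ⊗ rsign s ~> 𝟙;
  zigl : forall s, (dev s ⋆ lsign s) ∙ (lsign s ⋆ dcoev (opp s)) = lsign s;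
  zigr : forall s, (rsign s ⋆ dev s) ∙ (dcoev (opp s) ⋆ rsign s) = rsign s }.

Variable D : duality.

(** Compatibility with the four kinds of parallel pairs, tensored with [Y] on the
    left and with [Z] on the right.  Letting [s] vary, each of the two equations
    covers two kinds. *)
Definition balanced (Y X Z : C) (g : word -> mor C) : Prop := forall s i,
  g (s :: opp s :: i) ∙ (Y ⋆ lsign s ⋆ rsign s ⋆ lword i ⋆ X ⋆ rword i ⋆ dcoev D s ⋆ Z)
    = g i ∙ (Y ⋆ dev D s ⋆ lword i ⋆ X ⋆ rword i ⋆ Z) /\
  g (s :: opp s :: i) ∙ (Y ⋆ dcoev D s ⋆ lword i ⋆ X ⋆ rword i ⋆ lsign s ⋆ rsign s ⋆ Z)
    = g i ∙ (Y ⋆ lword i ⋆ X ⋆ rword i ⋆ dev D s ⋆ Z).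

(** [T] is a colimit of the objects [Y ⊗ F_i X ⊗ Z] along the relations of [balanced];
    the side objects are needed since the inverse of a fusion operator is defined
    on [T X ⊗ M]. *)
Definition universal (Y X Z T : C) (p : word -> mor C) : Prop :=
  (forall i, is_hom (p i) (Y ⊗ (lword i ⊗ (X ⊗ rword i) ⊗ Z)) T) /\
  balanced Y X Z p /\
  forall (W : C) (g : word -> mor C),
    (forall i, is_hom (g i) (Y ⊗ (lword i ⊗ (X ⊗ rword i) ⊗ Z)) W) ->
    balanced Y X Z g -> exists! K : T ~> W, forall i, K ∙ p i = g i.

Lemma balanced_comp (Y X Z : C) (u : mor C) g :
  balanced Y X Z g -> balanced Y X Z (fun i => u ∙ g i).
Proof. intros B s i; rewrite !mcompA; destruct (B s i) as [-> ->]; now split. Qed.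

Lemma universal_eq (Y X Z T T' : C) (p p' : word -> mor C) :
  T = T' -> (forall i, p i = p' i) -> universal Y X Z T p -> universal Y X Z T' p'.
Proof. intros <- E; now rewrite (functional_extensionality _ _ E). Qed.

Lemma universal_epi (Y X Z T W : C) (p : word -> mor C) (u v : T ~> W) :
  universal Y X Z T p -> (forall i, u ∙ p i = v ∙ p i) -> u = v.
Proof.
intros [Hp [Bp Up]] E.
destruct (Up W (fun i => v ∙ p i)) as [K [_ UK]].
- intros i; destruct (Hp i) as [f ->]; exists (v ∘ f); now rewrite mor_comp.
- now apply balanced_comp.
- rewrite <- (UK u E); now apply UK.
Qed.

(** The cup on [B_i ⊗ A_i]; the letter closest to [X] in [F_i X] has the outermost
    cup. *)
Fixpoint coevw (i : word) : mor C :=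
  match i with
  | [] => 𝟙 : C
  | s :: i => (rword i ⋆ dcoev D (opp s) ⋆ lword i) ∙ coevw i
  end.

Lemma lsign_opp s : lsign (opp s) = rsign s. Proof. now destruct s. Qed.
Lemma rsign_opp s : rsign (opp s) = lsign s. Proof. now destruct s. Qed.
(** Rewriting [lsign (opp s)] itself would also touch the types of [dcoev D (opp s)],
    hence the versions for identity morphisms. *)
Lemma id_lsign_opp s : lsign (opp s) = rsign s :> mor C. Proof. now rewrite lsign_opp. Qed.
Lemma id_rsign_opp s : rsign (opp s) = lsign s :> mor C. Proof. now rewrite rsign_opp. Qed.

Lemma src_coevw i : src (coevw i) = 𝟙.
Proof. now induction i. Qed.

Lemma tgt_coevw i : tgt (coevw i) = rword i ⊗ lword i.
Proof.
induction i as [|s i IH]; cbn [coevw lword rword]; autorewrite with ends; [reflexivity|].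
now rewrite lsign_opp, rsign_opp.
Qed.
End Words.

Hint Rewrite lsign_opp rsign_opp src_coevw tgt_coevw : ends.
Hint Rewrite id_lsign_opp id_rsign_opp : strict.

(** * Invertibility of the fusion operator *)

(** [M] is an algebra given by the actions of all words; [H] is the left fusion
    operator, seen through its composites with the universal maps. *)
Section Fusion.
Variables (C : smoncat) (P Q : C) (D : duality P Q) (M : C).
Notation L s := (lsign P Q s).
Notation R s := (rsign P Q s).
Notation Lw i := (lword P Q i).
Notation Rw i := (rword P Q i).
Variable act : forall i, Lw i ⊗ (M ⊗ Rw i) ~> M.
Hypothesis act_nil : act [] = M :> mor C.
Hypothesis act_cons : forall s i, act (s :: i) = act [s] ∙ (L s ⋆ act i ⋆ R s) :> mor C.
Hypothesis act_balanced : balanced D 𝟙 M 𝟙 act.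

Definition hbraid s : mor C := (act [opp s] ⋆ R s) ∙ (R s ⋆ M ⋆ dcoev D s).
Definition hbraid_inv s : mor C := (R s ⋆ act [s]) ∙ (dcoev D (opp s) ⋆ M ⋆ R s).

Fixpoint hbraidw (i : word) : mor C :=
  match i with
  | [] => M
  | s :: i => (hbraidw i ⋆ R s) ∙ (Rw i ⋆ hbraid s)
  end.
Definition hbraidw_inv i : mor C := (Rw i ⋆ act i) ∙ (coevw D i ⋆ M ⋆ Rw i).

Lemma act1_src s : Lw [s] ⊗ (M ⊗ Rw [s]) = L s ⊗ M ⊗ R s.
Proof. cbn [lword rword]. ends. Qed.

Definition act1 s : L s ⊗ M ⊗ R s ~> M := act [s] ∘ eqm (eq_sym (act1_src s)).

Lemma act1E s : act [s] = act1 s :> mor C.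
Proof. unfold act1; now rewrite mor_eqmr. Qed.

Lemma rel_r s : act1 s ∙ (L s ⋆ act1 (opp s) ⋆ R s) ∙ (L s ⋆ R s ⋆ M ⋆ dcoev D s)
  = dev D s ⋆ M.
Proof.
destruct (act_balanced s []) as [H _].
rewrite (act_cons s [opp s]), act_nil, !act1E in H.
cbn [lword rword] in H; autorewrite with strict in H.
rewrite mcomp1m in H by ends. exact H.
Qed.

Lemma rel_l s : act1 s ∙ (L s ⋆ act1 (opp s) ⋆ R s) ∙ (dcoev D s ⋆ M ⋆ L s ⋆ R s)
  = M ⋆ dev D s.
Proof.
destruct (act_balanced s []) as [_ H].
rewrite (act_cons s [opp s]), act_nil, !act1E in H.
cbn [lword rword] in H; autorewrite with strict in H.
rewrite mcomp1m in H by ends. exact H.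
Qed.

Lemma hbraidE s : hbraid s = (act1 (opp s) ⋆ R s) ∙ (R s ⋆ M ⋆ dcoev D s).
Proof. unfold hbraid; now rewrite act1E. Qed.

Lemma hbraid_invE s : hbraid_inv s = (R s ⋆ act1 s) ∙ (dcoev D (opp s) ⋆ M ⋆ R s).
Proof. unfold hbraid_inv; now rewrite act1E. Qed.

Lemma hbraidK s : hbraid s ∙ hbraid_inv s = M ⋆ R s.
Proof.
rewrite hbraidE, hbraid_invE.
pose proof (zigl D (opp s)) as Z; pose proof (rel_l (opp s)) as H.
destruct s; exact (half_braidingK Z H).
Qed.

Lemma hbraid_invK s : hbraid_inv s ∙ hbraid s = R s ⋆ M.
Proof.
rewrite hbraidE, hbraid_invE.
pose proof (zigr D s) as Z; pose proof (rel_r s) as H.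
destruct s; exact (half_braiding_invK Z H).
Qed.

Lemma hbraid_coev s :
  (hbraid (opp s) ⋆ R s) ∙ (L s ⋆ hbraid s) ∙ (dcoev D s ⋆ M) = M ⋆ dcoev D s.
Proof.
rewrite !hbraidE.
pose proof (zigl D s) as Z; pose proof (rel_l s) as H.
destruct s; exact (half_braiding_coev Z H).
Qed.

Lemma hbraid_ev s :
  (M ⋆ dev D s) ∙ (hbraid (opp s) ⋆ R s) ∙ (L s ⋆ hbraid s) = dev D s ⋆ M.
Proof.
rewrite !hbraidE.
pose proof (zigr D s) as Z; pose proof (rel_r s) as H.
destruct s; exact (half_braiding_ev Z H).
Qed.

Lemma src_hbraid s : src (hbraid s) = R s ⊗ M.
Proof. rewrite hbraidE; ends. Qed.
Lemma tgt_hbraid s : tgt (hbraid s) = M ⊗ R s.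
Proof. rewrite hbraidE; ends. Qed.
Lemma src_hbraid_inv s : src (hbraid_inv s) = M ⊗ R s.
Proof. rewrite hbraid_invE; ends. Qed.
Hint Rewrite src_hbraid tgt_hbraid src_hbraid_inv : ends.

Lemma src_hbraidw i : src (hbraidw i) = Rw i ⊗ M.
Proof. destruct i; cbn [hbraidw rword]; ends. Qed.
Lemma tgt_hbraidw i : tgt (hbraidw i) = M ⊗ Rw i.
Proof.
induction i as [|s i IH]; cbn [hbraidw rword]; autorewrite with ends; [reflexivity|].
now rewrite IH; autorewrite with ends.
Qed.
Lemma src_hbraidw_inv i : src (hbraidw_inv i) = M ⊗ Rw i.
Proof. unfold hbraidw_inv; ends. Qed.
Lemma tgt_hbraidw_inv i : tgt (hbraidw_inv i) = Rw i ⊗ M.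
Proof. unfold hbraidw_inv; ends. Qed.
Hint Rewrite src_hbraidw tgt_hbraidw src_hbraidw_inv tgt_hbraidw_inv : ends.

(** The formula for [hbraidw_inv] comes from [T_2], whereas the inverse is assembled
    letter by letter; the two meet because the cup of the first letter can be
    postponed until the rest of the word has acted. *)
Lemma hbraidw_inv_cons s i :
  hbraidw_inv (s :: i) = (Rw i ⋆ hbraid_inv s) ∙ (hbraidw_inv i ⋆ R s).
Proof.
unfold hbraidw_inv; rewrite hbraid_invE, act_cons, act1E; cbn [coevw lword rword].
rewrite <- !mor_tens; rewrite !whiskl, !whiskr by ends; autorewrite with strict.
slide (Rw i ⋆ dcoev D (opp s)) (act i ⋆ R s) as S. chain S.
reflexivity.
Qed.

Lemma hbraidw_inv_nil : hbraidw_inv [] = M.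
Proof.
unfold hbraidw_inv; rewrite act_nil; cbn [coevw lword rword].
autorewrite with strict; now rewrite mcomp1m.
Qed.

Lemma hbraidwK i : hbraidw i ∙ hbraidw_inv i = M ⋆ Rw i.
Proof.
induction i as [|s i IH]; cbn [hbraidw rword].
- rewrite hbraidw_inv_nil; autorewrite with strict; now rewrite mcomp1m.
- rewrite hbraidw_inv_cons; autorewrite with strict.
  whisker (Rw i) (hbraidK s) (𝟙 : C) as E. chain E. drop_id.
  whisker (𝟙 : C) IH (R s) as E'. exact E'.
Qed.

Lemma hbraidw_invK i : hbraidw_inv i ∙ hbraidw i = Rw i ⋆ M.
Proof.
induction i as [|s i IH]; cbn [hbraidw rword].
- rewrite hbraidw_inv_nil; autorewrite with strict; now rewrite mcomp1m.
- rewrite hbraidw_inv_cons; autorewrite with strict.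
  whisker (𝟙 : C) IH (R s) as E. chain E. drop_id.
  whisker (Rw i) (hbraid_invK s) (𝟙 : C) as E'. exact E'.
Qed.

Lemma hbraidw_defined i : defined (hbraidw i).
Proof.
induction i as [|s i IH]; cbn [hbraidw]; [apply hom_defined|].
rewrite hbraidE.
repeat (apply comp_defined || apply tens_defined || apply hom_defined || assumption || ends).
Qed.

Variables (X T N : C) (p q : word -> mor C) (H : N ~> T ⊗ M).
Hypothesis p_hom : forall i, is_hom (p i) (Lw i ⊗ (X ⊗ Rw i)) T.
Hypothesis p_univ : universal D 𝟙 X M (T ⊗ M) (fun i => p i ⋆ M).
Hypothesis q_univ : universal D 𝟙 (X ⊗ M) 𝟙 N q.
Hypothesis H_q : forall i,
  H ∙ q i = (p i ⋆ act i) ∙ (Lw i ⋆ X ⋆ coevw D i ⋆ M ⋆ Rw i).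

Lemma src_p i : src (p i) = Lw i ⊗ (X ⊗ Rw i).
Proof. destruct (p_hom i) as [f ->]; reflexivity. Qed.
Lemma tgt_p i : tgt (p i) = T.
Proof. destruct (p_hom i) as [f ->]; reflexivity. Qed.
Lemma src_q i : src (q i) = Lw i ⊗ (X ⊗ (M ⊗ Rw i)).
Proof. destruct q_univ as [q_hom _]. destruct (q_hom i) as [f ->]; ends. Qed.
Lemma tgt_q i : tgt (q i) = N.
Proof. destruct q_univ as [q_hom _]. destruct (q_hom i) as [f ->]; ends. Qed.
Hint Rewrite src_p tgt_p src_q tgt_q : ends.

Lemma H_qE i : H ∙ q i = (p i ⋆ M) ∙ (Lw i ⋆ X ⋆ hbraidw_inv i).
Proof.
rewrite H_q; unfold hbraidw_inv; rewrite !whiskl by ends; rewrite <- mcompA; f_equal.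
rewrite <- !(mtensA _ _ (act i)), <- !mor_tens.
rewrite <- mtens_comp, mcomp1m, mcompm1 by ends; reflexivity.
Qed.

(** A letter and its opposite, when added to [i], contribute to [hbraidw] the passage
    of [A_s ⊗ B_s] across [M].  A cup created to the right of [F_i X] passes to the
    right of [M], and a cap to the right of [M] can be applied before the passage:
    these are the two uses of the naturality of the half-braiding. *)
Lemma inverse_balanced : balanced D 𝟙 X M (fun i => q i ∙ (Lw i ⋆ X ⋆ hbraidw i)).
Proof.
intros s i; destruct q_univ as [_ [q_bal _]]; destruct (q_bal s i) as [B1 B2].
autorewrite with strict in B1, B2 |- *.
cbn [hbraidw lword rword].
rewrite !whiskl, !whiskr by ends; rewrite !whiskl by ends; autorewrite with strict.
split.
- whisker (L s ⊗ R s ⊗ Lw i ⊗ X ⊗ Rw i) (hbraid_coev s) (𝟙 : C) as E1. chain E1.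
  slide (L s ⋆ R s ⋆ Lw i ⋆ X ⋆ hbraidw i) (dcoev D s) as E2. chain <- E2.
  chain B1.
  slide (dev D s) (Lw i ⋆ X ⋆ hbraidw i) as E3. now chain <- E3.
- slide (dcoev D s) (Lw i ⋆ X ⋆ Rw i ⋆ L s ⋆ hbraid s) as E1. chain E1.
  slide (dcoev D s) (Lw i ⋆ X ⋆ Rw i ⋆ hbraid (opp s) ⋆ R s) as E2. chain E2.
  slide (dcoev D s) (Lw i ⋆ X ⋆ hbraidw i ⋆ L s ⋆ R s) as E3. chain E3.
  chain B2.
  slide (Lw i ⋆ X ⋆ hbraidw i) (dev D s) as E4. chain E4.
  whisker (Lw i ⊗ X ⊗ Rw i) (hbraid_ev s) (𝟙 : C) as E5. now chain E5.
Qed.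

Theorem fusion_iso : is_iso H.
Proof.
assert (g_hom : forall i,
  is_hom (q i ∙ (Lw i ⋆ X ⋆ hbraidw i)) (𝟙 ⊗ (Lw i ⊗ (X ⊗ Rw i) ⊗ M)) N).
{ intros i; apply defined_hom; [|ends|ends].
  apply comp_defined; [| |ends].
  - destruct q_univ as [q_hom _]; destruct (q_hom i) as [f ->]; apply hom_defined.
  - apply tens_defined, tens_defined, hbraidw_defined; apply hom_defined. }
destruct (p_univ) as [_ [_ U]], (U N _ g_hom inverse_balanced) as [K [HK _]].
exists K; split.
- apply (universal_epi q_univ); intros i.
  rewrite mor_comp, mcompA, H_qE, mor_id, mcomp1m by ends.
  rewrite <- mcompA, HK, mcompA.
  whisker (Lw i ⊗ X) (hbraidwK i) (𝟙 : C) as E. chain E. drop_id. reflexivity.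
- apply (universal_epi p_univ); intros i.
  rewrite mor_comp, mcompA, HK, mor_id, mcomp1m by ends.
  rewrite <- mcompA, H_qE, mcompA.
  whisker (Lw i ⊗ X) (hbraidw_invK i) (𝟙 : C) as E. chain E. drop_id. reflexivity.
Qed.
End Fusion.

(** * Colimits of functors are pointwise *)

Section Colimits.
Variables (J : graph) (C : category) (D : diagram J C) (c : cocone D).

Definition cocone_push (Z : C) (u : apex c ~> Z) : cocone D.
Proof.
refine {| apex := Z; leg := fun v => u ∘ leg c v |}.
intros v w e; now rewrite <- compA, legE.
Defined.

Hypothesis colim : is_colimit c.

Lemma colimit_epi (Z : C) (u v : apex c ~> Z) :
  (forall j, u ∘ leg c j = v ∘ leg c j) -> u = v.
Proof.
intros H; destruct (colim (cocone_push v)) as [h [_ Uh]].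
now rewrite <- (Uh u H), <- (Uh v (fun _ => eq_refl)).
Qed.

Definition colimit_desc (k : cocone D) : apex c ~> apex k :=
  proj1_sig (constructive_indefinite_description _ (colim k)).

Lemma colimit_descE (k : cocone D) j : colimit_desc k ∘ leg c j = leg k j.
Proof.
exact (proj1 (proj2_sig (constructive_indefinite_description _ (colim k))) j).
Qed.
End Colimits.

Section Pointwise.
Variables (J : graph) (C E : category) (D : diagram J (fcat C E)).
Hypothesis pointwise : forall X : C, has_colimit (map_diagram (evalF E X) D).

Let pt (X : C) : cocone (map_diagram (evalF E X) D) :=
  proj1_sig (constructive_indefinite_description _ (pointwise X)).

Let pt_colim (X : C) : is_colimit (pt X) :=
  proj2_sig (constructive_indefinite_description _ (pointwise X)).

Let shift (X Y : C) (f : X ~> Y) : cocone (map_diagram (evalF E X) D).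
Proof.
refine {| apex := apex (pt Y);
          leg := fun v => leg (pt Y) v ∘ fmap (D v : functor C E) f
                 : map_diagram (evalF E X) D v ~> apex (pt Y) |}.
intros u v e; simpl. rewrite <- compA, <- (ncompE (darr D e : nattrans _ _)), compA.
f_equal; exact (legE (pt Y) e).
Defined.

Definition pt_functor : functor C E.
Proof.
refine {| fob := fun X => apex (pt X);
          fmap := fun X Y f => colimit_desc (@pt_colim X) (shift f) |}.
- intros X; apply (colimit_epi (@pt_colim X)); intros v.
  etransitivity; [exact (colimit_descE (@pt_colim X) (shift (idm X)) v)|]; simpl.
  now rewrite fmap1, compm1, comp1m.
- intros X Y Z g f; apply (colimit_epi (@pt_colim X)); intros v.
  etransitivity; [exact (colimit_descE (@pt_colim X) (shift (g ∘ f)) v)|]; simpl.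
  rewrite <- compA.
  pose proof (colimit_descE (@pt_colim X) (shift f) v) as Ef.
  pose proof (colimit_descE (@pt_colim Y) (shift g) v) as Eg.
  simpl in Ef, Eg. rewrite Ef, compA, Eg, fmapM, compA; reflexivity.
Defined.

Definition pt_cocone : cocone D.
Proof.
refine (@Cocone J (fcat C E) D pt_functor
  (fun v => @NatTrans C E (D v) pt_functor (fun X => leg (pt X) v) _) _).
intros u v e; apply nattrans_ext; intros X; exact (legE (pt X) e).
Unshelve.
intros X Y f; symmetry; exact (colimit_descE (@pt_colim X) (shift f) v).
Defined.

(** The pointwise colimits assemble into a functor [pt_functor] under [D].  The
    comparison [sN] from it to the given colimit has the section [t], and this
    suffices to transport the universal property at each [X]. *)
Lemma eval_colimit (c : cocone D) : is_colimit c ->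
  forall X, is_colimit (map_cocone (evalF E X) c).
Proof.
intros colim.
destruct (colim pt_cocone) as [t [Ht _]].
pose (s X := colimit_desc (@pt_colim X) (map_cocone (evalF E X) c)).
assert (Hs : forall X v, s X ∘ leg (pt X) v = (leg c v : nattrans _ _) X).
{ intros X v; exact (colimit_descE (@pt_colim X) (map_cocone (evalF E X) c) v). }
assert (s_nat : forall X Y (f : X ~> Y),
  s Y ∘ fmap pt_functor f = fmap (apex c : functor C E) f ∘ s X).
{ intros X Y f; apply (colimit_epi (@pt_colim X)); intros v; simpl.
  pose proof (colimit_descE (@pt_colim X) (shift f) v) as Ef; simpl in Ef.
  pose proof (ncompE (leg c v : nattrans _ _) f) as N.
  pose proof (Hs X v) as EX; pose proof (Hs Y v) as EY; simpl in EX, EY.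
  rewrite <- !compA, Ef, EX, compA, EY; exact N. }
pose (sN := NatTrans s_nat : (pt_functor : fcat C E) ~> apex c).
assert (st : sN ∘ t = idm (apex c)).
{ apply (colimit_epi colim); intros v.
  rewrite <- compA, Ht, comp1m; apply nattrans_ext; intros X; apply Hs. }
intros X k; exists (colimit_desc (@pt_colim X) k ∘ (t : nattrans _ _) X); split.
- intros v. simpl. rewrite <- compA.
  etransitivity; [|exact (colimit_descE (@pt_colim X) k v)]. f_equal.
  exact (f_equal (fun n : nattrans _ _ => n X) (Ht v)).
- intros h Hh.
  assert (stX : s X ∘ (t : nattrans _ _) X = idm _)
    by exact (f_equal (fun n : nattrans _ _ => n X) st).
  rewrite <- (compm1 h); simpl; rewrite <- stX, compA; f_equal.
  apply (colimit_epi (@pt_colim X)); intros v.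
  rewrite colimit_descE, <- compA, Hs; symmetry; apply Hh.
Qed.
End Pointwise.
(** * Reversing the tensor product *)

(** The underlying category of [rev_smoncat] is that of [C], hence both have the
    same [mor] and the same isomorphisms.  Exchanging [P] and [Q] exchanges left
    and right legs of a word. *)
Section RevCat.
Variable C : smoncat.
Definition rev_smoncat : smoncat.
Proof.
refine (@SMonCat C (fun A B => B ⊗ A) 𝟙 (fun A B A' B' f g => g ⊠ f) _ _ _ _ _ _ _ _).
- intros A B; apply tensm_id.
- intros A B A' B' A'' B'' f' f g' g; apply tensm_comp.
- intros A B E; symmetry; apply tensA.
- intros A; apply tenso1.
- intros A; apply tens1o.
- intros A B E A' B' E' f g h; apply same_sym, tensmA.
- intros A A' f; apply tensm1.
- intros A A' f; apply tens1m.
Defined.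

Lemma mtens_rev (f g : mor C) : @mtens rev_smoncat f g = g ⋆ f.
Proof. now destruct f as [A A' [f|]], g as [B B' [g|]]. Qed.

Variables (P Q : C).
Lemma lword_rev i : @lword rev_smoncat Q P i = rword P Q i.
Proof. induction i as [|s i IH]; [reflexivity|]; cbn [lword rword]; now rewrite IH. Qed.
Lemma rword_rev i : @rword rev_smoncat Q P i = lword P Q i.
Proof. induction i as [|s i IH]; [reflexivity|]; cbn [lword rword]; now rewrite IH. Qed.

Definition rev_duality (D : duality P Q) : @duality rev_smoncat Q P.
Proof.
refine (@Duality rev_smoncat Q P (dcoev D) (dev D) _ _).
- intros s; rewrite !mtens_rev; exact (zigr D s).
- intros s; rewrite !mtens_rev; exact (zigl D s).
Defined.

Lemma coevw_rev D i : coevw (rev_duality D) i = coevw D i.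
Proof.
induction i as [|s i IH]; [reflexivity|].
cbn [coevw]; rewrite IH, !mtens_rev, lword_rev, rword_rev, mtensA; reflexivity.
Qed.

Lemma balanced_rev D (Y X Z : C) g :
  balanced (rev_duality D) Y X Z g <-> balanced D Z X Y g.
Proof.
split; intros B s i; destruct (B s i) as [B1 B2];
  rewrite !mtens_rev, !lword_rev, !rword_rev, !mtensA in *; split; assumption.
Qed.

Lemma fused_rev (Y X Z : C) i :
  @tens rev_smoncat Y (@tens rev_smoncat (@tens rev_smoncat (@lword rev_smoncat Q P i)
    (@tens rev_smoncat X (@rword rev_smoncat Q P i))) Z)
  = Z ⊗ (lword P Q i ⊗ (X ⊗ rword P Q i) ⊗ Y).
Proof. cbn [tens rev_smoncat]; now rewrite lword_rev, rword_rev, !tensA. Qed.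

Lemma universal_rev D (Y X Z T : C) p :
  universal D Z X Y T p -> universal (rev_duality D) Y X Z T p.
Proof.
intros [Hp [Bp U]]; split; [|split].
- intros i; rewrite fused_rev; apply Hp.
- now apply balanced_rev.
- intros W g Hg Bg; apply U; [|now apply balanced_rev].
  intros i; rewrite <- fused_rev; apply Hg.
Qed.
End RevCat.
(** * The data of the bimonad in terms of bundled morphisms *)

Section WordFunctors.
Variables (C : smoncat) (P Q : C).

Lemma Fword_ob i X : Fword P Q i X = lword P Q i ⊗ (X ⊗ rword P Q i).
Proof.
induction i as [|s i IH]; cbn [Fword lword rword].
- cbn; now rewrite tens1o, tenso1.
- cbn; rewrite IH; destruct s; cbn; now rewrite !tensA.
Qed.

Lemma Fword_mor i (X Y : C) (f : X ~> Y) :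
  fmap (Fword P Q i) f = lword P Q i ⋆ f ⋆ rword P Q i :> mor C.
Proof.
induction i as [|s i IH]; cbn [lword rword].
- now autorewrite with strict.
- destruct s; cbn; rewrite !mor_tensm, IH; autorewrite with strict; reflexivity.
Qed.

Variable d : pivotal_pair P Q.

Definition pivotal_duality : duality P Q.
Proof.
refine (@Duality C P Q
  (fun s => match s with plus => coev' d | minus => coev d end)
  (fun s => match s with plus => ev d | minus => ev' d end) _ _).
- intros []; cbn [lsign opp].
  + pose proof (same_mor (triangle2 d)) as E.
    rewrite mor_comp, mor_eqmr, !mor_tensm in E; exact E.
  + pose proof (same_mor (triangle2' d)) as E.
    rewrite mor_comp, mor_eqmr, !mor_tensm in E; exact E.
- intros []; cbn [rsign opp].
  + pose proof (same_mor (triangle1 d)) as E.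
    rewrite mor_comp, mor_eqmr, !mor_tensm in E; exact E.
  + pose proof (same_mor (triangle1' d)) as E.
    rewrite mor_comp, mor_eqmr, !mor_tensm in E; exact E.
Defined.
Notation D := pivotal_duality.

Lemma dual_words i : lword P Q (dualw i) = rword P Q i /\ rword P Q (dualw i) = lword P Q i.
Proof.
assert (app : forall i s, lword P Q (i ++ [s]) = lword P Q i ⊗ lsign P Q s /\
                          rword P Q (i ++ [s]) = rsign P Q s ⊗ rword P Q i).
{ intros j s; induction j as [|t j [IHl IHr]]; cbn [lword rword app].
  - now rewrite !tens1o, !tenso1.
  - now rewrite IHl, IHr, !tensA. }
unfold dualw; induction i as [|s i [IHl IHr]]; [now split|].
cbn [map rev lword rword]; destruct (app (rev (map opp i)) (opp s)) as [-> ->].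
now rewrite IHl, IHr, lsign_opp, rsign_opp.
Qed.

Lemma coev_wordE i : coev_word d i = coevw D i :> mor C.
Proof.
induction i as [|s i IH]; [reflexivity|].
cbn [coev_word coevw]. rewrite mor_comp, IH, mor_eqml, Fword_mor.
destruct (dual_words i) as [-> ->]; do 3 f_equal.
destruct s; apply mor_eqml.
Qed.

Lemma Fword_id i X : Fword P Q i X = lword P Q i ⋆ X ⋆ rword P Q i :> mor C.
Proof. now rewrite Fword_ob, !mor_tens. Qed.

Lemma sandwich2E (A B : C) G X : sandwich2 A B G X = A ⋆ B ⋆ G X ⋆ A ⋆ B :> mor C.
Proof. cbn; rewrite mor_eqm; autorewrite with strict; reflexivity. Qed.
Lemma sandwich2E' (A B : C) G X : sandwich2' A B G X = A ⋆ B ⋆ G X ⋆ A ⋆ B :> mor C.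
Proof. cbn; rewrite mor_eqm; autorewrite with strict; reflexivity. Qed.

Lemma insrE (G : functor C C) Z (u : 𝟙 ~> Z) X : insr G u X = G X ⋆ u :> mor C.
Proof. cbn; now rewrite mor_eqmr. Qed.
Lemma inslE (G : functor C C) Z (u : 𝟙 ~> Z) X : insl G u X = u ⋆ G X :> mor C.
Proof. cbn; now rewrite mor_eqmr. Qed.
Lemma delrE (G : functor C C) Z (u : Z ~> 𝟙) X : delr G u X = G X ⋆ u :> mor C.
Proof. cbn; now rewrite mor_eqml. Qed.
Lemma dellE (G : functor C C) Z (u : Z ~> 𝟙) X : dell G u X = u ⋆ G X :> mor C.
Proof. cbn; now rewrite mor_eqml. Qed.
(** The letter [s] for which the given kind of pair is an instance of [balanced]. *)
Definition rel_sign (k : rel) := match k with rel1 | rel4 => minus | _ => plus end.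

Lemma rel_fstE k i X : rel_fst d k i X =
  match k with
  | rel1 | rel3 => lsign P Q (rel_sign k) ⋆ rsign P Q (rel_sign k)
                     ⋆ lword P Q i ⋆ X ⋆ rword P Q i ⋆ dcoev D (rel_sign k)
  | rel2 | rel4 => dcoev D (rel_sign k) ⋆ lword P Q i ⋆ X ⋆ rword P Q i
                     ⋆ lsign P Q (rel_sign k) ⋆ rsign P Q (rel_sign k)
  end :> mor C.
Proof.
destruct k; cbn [rel_fst compN ncomp];
  rewrite mor_comp, ?sandwich2E, ?sandwich2E', ?insrE, ?inslE;
  cbn [compF fob tensl tensr rel_sign lsign rsign]; rewrite ?mor_tens, Fword_id;
  autorewrite with strict; drop_id; reflexivity.
Qed.

Lemma rel_sndE k i X : rel_snd d k i X =
  match k with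
  | rel1 | rel3 => dev D (rel_sign k) ⋆ lword P Q i ⋆ X ⋆ rword P Q i
  | rel2 | rel4 => lword P Q i ⋆ X ⋆ rword P Q i ⋆ dev D (rel_sign k)
  end :> mor C.
Proof.
destruct k; cbn [rel_snd rel_src rel_sign]; rewrite ?dellE, ?delrE, Fword_id;
  autorewrite with strict; reflexivity.
Qed.

Lemma balancedP Y X Z g : balanced D Y X Z g <-> forall k i,
  g (rel_word k i) ∙ (Y ⋆ rel_fst d k i X ⋆ Z) = g i ∙ (Y ⋆ rel_snd d k i X ⋆ Z).
Proof.
split.
- intros B k i; rewrite rel_fstE, rel_sndE.
  destruct (B (rel_sign k) i) as [B1 B2].
  destruct k; autorewrite with strict; assumption.
- intros B [] i; [split; [pose proof (B rel3 i) as E|pose proof (B rel2 i) as E]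
                 |split; [pose proof (B rel1 i) as E|pose proof (B rel4 i) as E]];
  rewrite rel_fstE, rel_sndE in E; autorewrite with strict in E; exact E.
Qed.
End WordFunctors.

Section Psi.
Variables (C : smoncat).
Hypothesis tensl_colim : forall A : C, preserves_colimits (tensl A).
Hypothesis tensr_colim : forall A : C, preserves_colimits (tensr A).
Variables (P Q : C) (d : pivotal_pair P Q).
Variable coF : cocone (words_diagram P Q).
Hypothesis coF_colim : is_colimit coF.
Hypothesis coF_exists : forall X : C,
  has_colimit (map_diagram (evalF C X) (words_diagram P Q)).
Variable coT : cocone (pairs_diagram d coF).
Hypothesis coT_colim : is_colimit coT.
Hypothesis coT_exists : forall X : C,
  has_colimit (map_diagram (evalF C X) (pairs_diagram d coF)).
Notation D := (pivotal_duality d).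
Notation T := (apex coT : functor C C).

Lemma psi_rel k i X :
  psi coT (rel_word k i) X ∘ rel_fst d k i X = psi coT i X ∘ rel_snd d k i X.
Proof.
pose proof (legE coT (fst_edge k i)) as E1; pose proof (legE coT (snd_edge k i)) as E2.
pose proof (f_equal (fun n : nattrans _ _ => n X) (eq_trans E1 (eq_sym E2))) as E.
cbn in E |- *. now rewrite <- !compA.
Qed.

(** A compatible family first descends to [G (F^* X)] and then, by compatibility, to
    a cocone on the image of the diagram of parallel pairs. *)
Lemma psi_desc (G : functor C C) (Gcolim : preserves_colimits G) (X W : C)
    (g : forall i, G (Fword P Q i X) ~> W) :
  (forall k i, g (rel_word k i) ∘ fmap G (rel_fst d k i X)
                 = g i ∘ fmap G (rel_snd d k i X)) ->
  exists! K : G (T X) ~> W, forall i, K ∘ fmap G (psi coT i X) = g i.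
Proof.
intros Hg.
pose proof (Gcolim _ _ _ (@eval_colimit _ _ _ _ coF_exists _ coF_colim X)) as colF.
pose proof (Gcolim _ _ _ (@eval_colimit _ _ _ _ coT_exists _ coT_colim X)) as colT.
pose (kF := @Cocone words_graph C
  (map_diagram G (map_diagram (evalF C X) (words_diagram P Q))) W g
  (fun u v e => match e with end)).
destruct (colF kF) as [h [Hh Uh]]; cbn in h, Hh, Uh.
pose (l := fun v : pairs_graph =>
  match v return G ((pairs_ob coF v : functor C C) X) ~> W with
  | source k i => g i ∘ fmap G (rel_snd d k i X)
  | target => h
  end).
assert (lE : forall u v (e : @edge pairs_graph u v),
  l v ∘ fmap G ((darr (pairs_diagram d coF) e : nattrans _ _) X) = l u).
{ intros u v []; cbn; rewrite fmapM, compA.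
  - rewrite <- Hg. f_equal. apply (Hh (rel_word k i)).
  - f_equal; apply (Hh i). }
pose (kT := @Cocone pairs_graph C
  (map_diagram G (map_diagram (evalF C X) (pairs_diagram d coF))) W l lE).
destruct (colT kT) as [K [HK UK]]; cbn in K, HK, UK.
exists K; split.
- intros i; cbn; rewrite fmapM, compA.
  rewrite <- (Hh i); f_equal; apply (HK target).
- intros K' HK'; apply UK; intros v.
  assert (E : K' ∘ fmap G ((leg coT (target : pairs_graph) : nattrans _ _) X) = h).
  { symmetry; apply Uh; intros i. rewrite <- HK'; cbn; now rewrite fmapM, compA. }
  destruct v as [k i|]; [|exact E].
  cbn. pose proof (f_equal (fun n : nattrans _ _ => n X) (legE coT (snd_edge k i))) as L.
  cbn in L, E. rewrite <- L, fmapM, compA, E, fmapM, compA; f_equal; apply (Hh i).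
Qed.

Definition twosided (Y Z : C) : functor C C := compF (tensl Y) (tensr Z).

Lemma twosided_colim (Y Z : C) : preserves_colimits (twosided Y Z).
Proof.
intros J K c colim. exact (tensl_colim (tensr_colim colim)).
Qed.

Lemma twosided_mor (Y Z A B : C) (f : A ~> B) :
  fmap (twosided Y Z) f = Y ⋆ f ⋆ Z :> mor C.
Proof. reflexivity. Qed.

Lemma psi_hom (Y X Z : C) i :
  is_hom (Y ⋆ psi coT i X ⋆ Z) (Y ⊗ (lword P Q i ⊗ (X ⊗ rword P Q i) ⊗ Z)) (Y ⊗ (T X ⊗ Z)).
Proof.
rewrite <- Fword_ob. now exists (fmap (twosided Y Z) (psi coT i X)).
Qed.

Lemma psi_balanced (Y X Z : C) : balanced D Y X Z (fun i => Y ⋆ psi coT i X ⋆ Z).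
Proof.
apply balancedP; intros k i.
rewrite <- !twosided_mor, <- !mor_comp, <- !fmapM; now rewrite psi_rel.
Qed.

Lemma psi_universal (Y X Z : C) :
  universal D Y X Z (Y ⊗ (T X ⊗ Z)) (fun i => Y ⋆ psi coT i X ⋆ Z).
Proof.
split; [intros i; apply psi_hom|]; split; [apply psi_balanced|].
intros W g Hg Bg.
assert (Hg' : forall i, is_hom (g i) (twosided Y Z (Fword P Q i X)) W).
{ intros i; cbn; rewrite Fword_ob; apply Hg. }
pose (g0 i := proj1_sig (constructive_indefinite_description _ (Hg' i))).
assert (Eg : forall i, g i = g0 i).
{ intros i; exact (proj2_sig (constructive_indefinite_description _ (Hg' i))). }
destruct (psi_desc (twosided_colim (Y:=Y) (Z:=Z)) (g := g0)) as [K [HK UK]].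
- intros k i; apply mor_inj; rewrite !mor_comp, <- !Eg, !twosided_mor.
  revert k i; now apply balancedP.
- exists K; split.
  + intros i; rewrite Eg, <- HK; now rewrite mor_comp.
  + intros K' HK'; apply UK; intros i; apply mor_inj.
    rewrite mor_comp, <- Eg; apply HK'.
Qed.
End Psi.
(** * Free algebras and fusion operators *)

Section Action.
Variables (C : smoncat) (P Q : C) (d : pivotal_pair P Q).
Variable coF : cocone (words_diagram P Q).
Variable coT : cocone (pairs_diagram d coF).
Notation T := (apex coT : functor C C).
Variable B : bimonad T.
Hypothesis S : is_T_structure B.
Notation D := (pivotal_duality d).
Variable Y : C.

(** The free algebra [T Y], seen as an object with an action of every word. *)
Definition free_act i : Fword P Q i (T Y) ~> T Y := mu B Y ∘ psi coT i (T Y).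

Lemma free_act_nil : free_act [] = T Y :> mor C.
Proof.
unfold free_act; rewrite <- (eta_psi S).
exact (f_equal (@hom_mor _ _ _) (mu_eta B Y)).
Qed.

(** Both sides are [mu] applied twice to [psi_s (psi_i)], associated differently. *)
Lemma free_act_cons s i :
  free_act (s :: i) = free_act [s] ∙ (lsign P Q s ⋆ free_act i ⋆ rsign P Q s) :> mor C.
Proof.
transitivity (free_act [s] ∘ fmap (Fword P Q [s]) (free_act i) : mor C).
- pose proof (same_mor (eq_same (mu_psi S [s] i (T Y)))) as E.
  rewrite mor_eqmr in E.
  unfold free_act at 1; rewrite mor_comp.
  etransitivity; [exact (f_equal (mcomp (mu B Y)) (eq_sym E))|].
  rewrite <- mor_comp; f_equal.
  pose proof (mu_assoc B Y) as A; pose proof (ncompE (psi coT [s]) (mu B Y)) as N.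
  cbn [compF fob fmap] in A, N. unfold free_act.
  rewrite fmapM, !compA.
  apply (f_equal (fun u => u ∘ fmap (Fword P Q [s]) (psi coT i (T Y)))).
  transitivity (mu B Y ∘ fmap T (mu B Y) ∘ psi coT [s] (T (T Y))).
  + exact (f_equal (fun u => u ∘ psi coT [s] (T (T Y))) (eq_sym A)).
  + rewrite <- !compA; f_equal; exact (eq_sym N).
- rewrite mor_comp, Fword_mor; cbn [lword rword]; now autorewrite with strict.
Qed.

Lemma free_act_balanced : balanced D 𝟙 (T Y) 𝟙 free_act.
Proof.
intros s i; destruct (balanced_comp (mu B Y) (psi_balanced coT 𝟙 (T Y) 𝟙) s i) as [B1 B2].
unfold free_act; rewrite !mor_comp. autorewrite with strict in *. now split.
Qed.
End Action.

Section FusionOperators.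
Variable C : smoncat.
Hypothesis tensl_colim : forall A : C, preserves_colimits (tensl A).
Hypothesis tensr_colim : forall A : C, preserves_colimits (tensr A).
Variables (P Q : C) (d : pivotal_pair P Q).
Variable coF : cocone (words_diagram P Q).
Hypothesis coF_colim : is_colimit coF.
Hypothesis coF_exists : forall X : C,
  has_colimit (map_diagram (evalF C X) (words_diagram P Q)).
Variable coT : cocone (pairs_diagram d coF).
Hypothesis coT_colim : is_colimit coT.
Hypothesis coT_exists : forall X : C,
  has_colimit (map_diagram (evalF C X) (pairs_diagram d coF)).
Notation T := (apex coT : functor C C).
Variable B : bimonad T.
Hypothesis S : is_T_structure B.
Notation D := (pivotal_duality d).

(** The inserted [coev_i] fills the middle of [F_i(X ⊗ F_{i^*}(1) ⊗ Y)], where it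
    separates [B_i] from [A_i]. *)
Lemma cop_psi_mor i (X Y : C) :
  cop B X Y ∙ psi coT i (X ⊗ Y) =
  (psi coT i X ⋆ psi coT i Y) ∙
    (lword P Q i ⋆ X ⋆ coevw D i ⋆ Y ⋆ rword P Q i).
Proof.
rewrite <- mor_comp, (cop_psi S i X Y), !mor_comp, mor_tensm, Fword_mor.
cbn beta; rewrite mor_eqmr, !mor_tensm, coev_wordE, mor_eqm, !mor_id.
rewrite Fword_tens, mcompm1 by reflexivity.
autorewrite with strict; reflexivity.
Qed.

Lemma fusion_l_psi i (X Y : C) :
  fusion_l B X Y ∙ psi coT i (X ⊗ T Y) =
  (psi coT i X ⋆ free_act B Y i) ∙
    (lword P Q i ⋆ X ⋆ coevw D i ⋆ T Y ⋆ rword P Q i).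
Proof.
unfold fusion_l, free_act.
rewrite mor_comp, mcompA, cop_psi_mor, mor_tensm, mor_comp, <- mcompA, <- mtens_comp
  by reflexivity.
now rewrite mor_id, mcomp1m by reflexivity.
Qed.

Lemma fusion_r_psi i (X Y : C) :
  fusion_r B X Y ∙ psi coT i (T X ⊗ Y) =
  (free_act B X i ⋆ psi coT i Y) ∙
    (lword P Q i ⋆ T X ⋆ coevw D i ⋆ Y ⋆ rword P Q i).
Proof.
unfold fusion_r, free_act.
rewrite mor_comp, mcompA, cop_psi_mor, mor_tensm, mor_comp, <- mcompA, <- mtens_comp
  by reflexivity.
now rewrite mor_id, mcomp1m by reflexivity.
Qed.

Lemma psi_typed i X : is_hom (psi coT i X) (lword P Q i ⊗ (X ⊗ rword P Q i)) (T X).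
Proof. rewrite <- Fword_ob; now exists (psi coT i X). Qed.

Lemma psi_universal_right (X Y : C) : universal D 𝟙 X Y (T X ⊗ Y) (fun i => psi coT i X ⋆ Y).
Proof.
refine (universal_eq _ _ (psi_universal tensl_colim tensr_colim coF_colim coF_exists
   coT_colim coT_exists 𝟙 X Y)); [apply tens1o|intros i; apply mtens1m].
Qed.

Lemma psi_universal_left (X Y : C) : universal D Y X 𝟙 (Y ⊗ T X) (fun i => Y ⋆ psi coT i X).
Proof.
refine (universal_eq _ _ (psi_universal tensl_colim tensr_colim coF_colim coF_exists
   coT_colim coT_exists Y X 𝟙)); [ends|intros i; now autorewrite with strict].
Qed.

Lemma psi_universal_plain (X : C) : universal D 𝟙 X 𝟙 (T X) (fun i => psi coT i X).
Proof.
refine (universal_eq _ _ (psi_universal_right X 𝟙));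
  [ends|intros i; now autorewrite with strict].
Qed.

Lemma fusion_l_iso X Y : is_iso (fusion_l B X Y).
Proof.
pose (act i := free_act B Y i ∘ eqm (eq_sym (Fword_ob P Q i (T Y)))).
assert (actE : forall i, act i = free_act B Y i :> mor C) by (intros i; apply mor_eqmr).
apply (@fusion_iso C P Q D (T Y) act) with (X := X) (p := fun i => psi coT i X)
  (q := fun i => psi coT i (X ⊗ T Y)).
- rewrite actE; now apply free_act_nil.
- intros s i; rewrite !actE; now apply free_act_cons.
- intros s i; rewrite !actE; apply free_act_balanced.
- intros i; apply psi_typed.
- apply psi_universal_right.
- apply psi_universal_plain.
- intros i; rewrite actE. apply fusion_l_psi.
Qed.

(** In the reversed category the algebra [T X] stands to the right of [Y], so that
    the left fusion argument applies with the side objects exchanged. *)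
Lemma fusion_r_iso X Y : is_iso (fusion_r B X Y).
Proof.
assert (e : forall i, @tens (rev_smoncat C) (@lword (rev_smoncat C) Q P i)
    (@tens (rev_smoncat C) (T X) (@rword (rev_smoncat C) Q P i)) = Fword P Q i (T X)).
{ intros i; cbn [tens rev_smoncat]; now rewrite lword_rev, rword_rev, Fword_ob, tensA. }
pose (act i := free_act B X i ∘ eqm (e i)).
assert (actE : forall i, act i = free_act B X i :> mor C) by (intros i; apply mor_eqmr).
apply (@fusion_iso (rev_smoncat C) Q P (rev_duality D) (T X) act) with (X := Y)
  (p := fun i => psi coT i Y) (q := fun i => psi coT i (T X ⊗ Y)) (T := T Y).
- exact (eq_trans (actE []) (free_act_nil S X)).
- intros s i; rewrite !actE, !mtens_rev, mtensA; exact (free_act_cons S X s i).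
- refine (proj2 (balanced_rev D (𝟙 : C) (T X) (𝟙 : C) (fun i => act i)) _).
  intros s i; rewrite !actE; apply free_act_balanced.
- intros i; cbn [tens rev_smoncat]; rewrite lword_rev, rword_rev, tensA; apply psi_typed.
- refine (universal_eq eq_refl _ (universal_rev (psi_universal_left Y (T X)))).
  intros i; symmetry; apply mtens_rev.
- exact (universal_rev (psi_universal_plain (T X ⊗ Y))).
- intros i; rewrite actE, !mtens_rev, coevw_rev, lword_rev, rword_rev, !mtensA.
  exact (fusion_r_psi i X Y).
Qed.
End FusionOperators.

Theorem theorem4p15 (C : smoncat)
    (tensl_colim : forall A : C, preserves_colimits (tensl A))
    (tensr_colim : forall A : C, preserves_colimits (tensr A))
    (P Q : C) (d : pivotal_pair P Q)
    (coF : cocone (words_diagram P Q))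
    (coF_colim : is_colimit coF)
    (coF_exists : forall X : C,
        has_colimit (map_diagram (evalF C X) (words_diagram P Q)))
    (coT : cocone (pairs_diagram d coF))
    (coT_colim : is_colimit coT)
    (coT_exists : forall X : C,
        has_colimit (map_diagram (evalF C X) (pairs_diagram d coF)))
    (B : bimonad (apex coT : functor C C))
    (B_structure : is_T_structure B) :
  is_hopf_monad B.
Proof.
intros X Y; split.
- exact (fusion_l_iso tensl_colim tensr_colim coF_colim coF_exists
           coT_colim coT_exists B_structure X Y).
- exact (fusion_r_iso tensl_colim tensr_colim coF_colim coF_exists
           coT_colim coT_exists B_structure X Y).
Qed.
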